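(* Let $Y_n^{(0)}$ and $Y_n^{(1)}$ respectively be the number of nodes of outdegree $0$ and outdegree $1$ of a preferential attachment circuit with index $m$ at time $n$. For $m \ge 2$, as $n\to\infty$, \begin{equation*} \frac{1}{\sqrt n}\left(\begin{pmatrix} Y_n^{(0)} \\ Y_n^{(1)} \end{pmatrix} - \begin{pmatrix} \frac{m + 1}{2m + 1} \\ \frac{m(m + 1)}{(3m + 1)(2m + 1)} \end{pmatrix} n \right) \overset{D}{\longrightarrow} \mathcal{N}_2 \left( \mathbf{0}, \tilde{\mathbf{\Sigma}} \right), \end{equation*} where $$ \tilde{\mathbf{\Sigma}} = \begin{pmatrix} \frac{2m^2(m + 1)}{(3m + 1)(2m + 1)^2} & -\frac{4(m + 1)^2m^2}{(4m + 1)(3m + 1)(2m + 1)^2} \\ -\frac{4(m + 1)^2m^2}{(4m + 1)(3m + 1)(2m + 1)^2} & \frac{2m^2(m + 1)(48m^3 + 59m^2 + 27m + 4)}{(5m + 1)(4m + 1)(3m + 1)^2(2m + 1)^2} \end{pmatrix}. $$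
   Context: A preferential dynamic attachment circuit of index $m$ starts at time $0$ with a single node $0$. At time $n\ge1$ a new node $n$ is added and chooses $m$ parents one at a time, with replacement, from the existing nodes; at each of these $m$ steps an existing node $v$ is chosen with probability proportional to its current outdegree plus one (outdegrees are updated after each of the $m$ choices), and an edge is drawn from the chosen parent to node $n$. $\mathcal{N}_2(\mathbf{0},\tilde{\mathbf{\Sigma}})$ denotes a bivariate normal vector with mean zero and covariance matrix $\tilde{\mathbf{\Sigma}}$. *)

(* Defs.v *)
From HB Require Import structures.
From mathcomp Require Import all_boot all_order all_algebra.
From mathcomp Require Import all_classical all_reals all_analysis.
Set Implicit Arguments. Unset Strict Implicit. Unset Printing Implicit Defensive.
Import Order.TTheory GRing.Theory Num.Theory.
Import numFieldNormedType.Exports.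
Local Open Scope classical_set_scope.
Local Open Scope ring_scope.

(* A state of the circuit = the sequence of outdegrees of nodes 0..k-1.
   A (finitely supported) distribution over states is a list of weighted
   outcomes (state, probability). *)

Definition pick_step (R : realType) (s : seq (seq nat * R)) : seq (seq nat * R) :=
  flatten (map (fun x : seq nat * R =>
    let: (d, p) := x in
    map (fun i => (incr_nth d i,
                   p * ((nth 0%N d i).+1)%:R / (sumn (map succn d))%:R))
        (iota 0 (size d))) s).

(* One time step: the new node chooses m parents one at a time (with
   replacement, degrees updated after each choice), then joins with outdegree 0. *)
Definition node_step (R : realType) (m : nat) (s : seq (seq nat * R))
  : seq (seq nat * R) :=
  map (fun x : seq nat * R => (rcons x.1 0%N, x.2)) (iter m (@pick_step R) s).

Definition pac_dist (R : realType) (m n : nat) : seq (seq nat * R) :=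
  iter n (node_step m) [:: ([:: 0%N], 1)].

Definition Ydeg (k : nat) (d : seq nat) : nat := count (pred1 k) d.

Definition pac_expect (R : realType) (m n : nat) (g : seq nat -> R) : R :=
  \sum_(x <- pac_dist R m n) x.2 * g x.1.

(* Density of the bivariate normal N_2(0, Sigma), Sigma = [[a, b], [b, c]]
   positive definite: (2 pi sqrt(det))^-1 exp(-1/2 v^T Sigma^-1 v). *)
Definition binormal_pdf (R : realType) (a b c : R) (v : R * R) : R :=
  let D := a * c - b ^+ 2 in
  (2 * pi * Num.sqrt D)^-1 *
  expR (- (c * v.1 ^+ 2 - 2 * b * v.1 * v.2 + a * v.2 ^+ 2) / (2 * D)).

Definition binormal_expect (R : realType) (a b c : R) (f : R * R -> R) : R :=
  fine (\int[(@lebesgue_measure R) \x (@lebesgue_measure R)]_v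
          (f v * binormal_pdf a b c v)%:E).

(* Convergence in distribution of the R^2-valued random vectors X_n (each given
   as a discrete law) to N_2(0, Sigma): E f(X_n) -> E f(N) for every bounded
   continuous f : R^2 -> R. *)
Definition cvg_dist_binormal (R : realType) (E : nat -> (R * R -> R) -> R)
  (a b c : R) : Prop :=
  forall f : R * R -> R, continuous f -> (exists M : R, forall v, `|f v| <= M) ->
    (fun n => E n f) @ \oo --> binormal_expect a b c f.

(* Main.v *)
Require Import Defs.
From HB Require Import structures.
From mathcomp Require Import all_boot all_order all_algebra.
From mathcomp Require Import all_classical all_reals all_analysis.
From mathcomp Require Import measurable_realfun.
From mathcomp Require Import zify ring lra.
Import Order.TTheory GRing.Theory Num.Theory.
Import numFieldNormedType.Exports.
Local Open Scope classical_set_scope.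
Local Open Scope ring_scope.

(** The total weight [w] never depends on the random choices: outdegrees add up to the number of
    picks made, so one pick is an affine recursion with known coefficients and only the law of the
    jump depends on the state. That dependence costs a squared deviation over [w ^+ 2] in the error
    of each pick, which is why a second moment bound of order [w] comes before any characteristic
    function; the same bound later serves as tightness.

    The factor [|al| + |be|] in the error of one pick is decisive. A bare [O(1 / n)] per pick would
    sum to a logarithm; the factor is of order [1 / sqrt n] at the frequencies of interest and turns
    that sum into a null sequence.

    Each pick trades the frequencies [(al, be)] for [(al (1 - 1/w), be (1 - 2/w))] one pick earlier.
    They only shrink backwards in time, so a bound fixed at the final time persists down to time 0,
    provided the induction quantifies over all frequencies.

    The phase [th] keeps everything real: the cosines with arbitrary phase carry the real and
    imaginary parts of the characteristic function together. *)

(** Write [U] and [X] for the numbers of nodes of outdegree 0 and 1. One pick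
   from a circuit of total weight [w] moves [(U, U - X)] by a bounded amount
   whose conditional mean is [(- U / w, - 2 (U - X) / w)]: these coordinates
   diagonalize the drift. Hence, for the centred pair [(x, y)],
     [E cos (al x' + be y' + th)
        = exp (- q (al, be) / 2) E cos (al (1 - 1/w) x + be (1 - 2/w) y + th)]
   up to an error [O((|al| + |be|) / n)] when [al, be = O(1 / sqrt n)]. The
   Gaussian exponents [exp (- n Q / 2)] satisfy the same recursion, because the
   covariance solves the Lyapunov equation of the drift, so the errors only add
   up to a harmonic sum, which is [o(sqrt n)], times [(|al| + |be|)].

   Convergence of these characteristic functions gives convergence in law:
   a bounded continuous [f] agrees on a large square with a continuous function
   of [(sin (p v.1), sin (p v.2))], which Bernstein polynomials approximate
   uniformly by trigonometric polynomials; what is lost outside of the square is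
   controlled by second moments. *)

(** * Gaussian integrals *)

Section Gaussian.
Context {R : realType}.
Let mu := @lebesgue_measure R.

(** The fundamental theorem of calculus on [[-n, n]] followed by dominated convergence; limits of
    [F] are only needed along integers. *)
Lemma integral_derive_eq0 (F h : R -> R) :
  (forall x, is_derive x (1 : R) F (h x)) -> continuous h ->
  mu.-integrable setT (EFin \o h) ->
  (fun n : nat => F n%:R) @ \oo --> 0 -> (fun n : nat => F (- n%:R)) @ \oo --> 0 ->
  (\int[mu]_x (h x)%:E)%E = 0%E.
Proof.
move=> dF ch ih F1 F2.
pose f_ (n : nat) x := (h x * \1_(`[- n%:R, n%:R]%classic : set R) x)%:E.
have [mh _] := integrableP _ _ _ ih.
have [|||||_ _ cvI] := @dominated_convergence _ _ _ mu setT measurableT f_ (EFin \o h)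
  (abse \o (EFin \o h)).
- move=> n; apply/measurable_EFinP; apply: measurable_funM; first exact/measurable_EFinP.
  exact: measurable_indic.
- by [].
- apply: aeW => x _.
  apply: cvg_near_cst.
  exists (Num.truncn `|x|).+1 => // n /= hn.
  rewrite /f_ indicE mem_set ?mulr1//= in_itv/= -ler_norml.
  apply: ltW; apply: (lt_le_trans (truncnS_gt _)).
  by rewrite ler_nat.
- by apply: integrable_abse.
- apply: aeW => x n _; rewrite /f_ indicE /= lee_fin; case: (x \in _);
    rewrite ?mulr1// mulr0 normr0//.
apply/esym; apply: (cvg_unique _ _ cvI) => //.
have -> : [sequence (\int[mu]_x f_ n x)%E]_n = (fun n => (F n%:R - F (- n%:R))%:E).
  apply/funext => n /=.
  transitivity (\int[mu]_(x in `[(- n%:R)%R, n%:R%R]) (h x)%:E)%E.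
    rewrite [RHS]integral_mkcond; apply: eq_integral => x _.
    by rewrite /f_ patchE indicE; case: (x \in _); rewrite ?mulr1// mulr0.
  (* For [n = 0] the interval is a point, which the fundamental theorem excludes. *)
  case: n => [|n]; first by rewrite oppr0 subrr set_itv1 integral_set1.
  have lt : - n.+1%:R < n.+1%:R :> R by rewrite gtrN.
  rewrite (@continuous_FTC2 _ _ F _ _ lt) ?EFinB//.
  - exact: continuous_subspaceT.
  - have cF : continuous F by move=> x; apply: differentiable_continuous;
      apply/derivable1_diffP; apply: ex_derive.
    split.
    + by move=> x _; apply: ex_derive.
    + by apply: cvg_at_right_filter; apply: cF.
    + by apply: cvg_at_left_filter; apply: cF.
  - by move=> x _; rewrite derive1E derive_val.
rewrite (_ : 0%E = (0 - 0 : R)%:E); last by rewrite subr0.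
apply: cvg_EFin; first exact: nearW.
exact: cvgB.
Qed.

Lemma is_derive_normal_pdf (m s : R) : s != 0 -> forall x : R,
  is_derive x (1 : R) (normal_pdf m s) (- ((x - m) / s ^+ 2) * normal_pdf m s x).
Proof.
move=> s0 x; rewrite normal_pdfE//= /normal_fun.
apply: is_derive_eq.
rewrite !scaler0 !add0r /GRing.scale/=.
by field.
Qed.

(** The linear factor is absorbed by a Gaussian of doubled standard deviation. With
    [u = z ^+ 2 / (8 s ^+ 2)] the two exponents are [- 4 u] and [- u], and [|z| <= 4 |s| expR u]
    fits in the gap. The constant [K] also exchanges the two normalizations. *)
Lemma integrable_center_normal_pdf (m s : R) : s != 0 ->
  mu.-integrable setT (fun y => (`|y - m| * normal_pdf m s y)%:E).
Proof.
move=> s0.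
have s20 : 2 * s != 0 by rewrite mulf_neq0// pnatr_eq0.
have i2 := integrable_normal_pdf m (2 * s).
pose K := 4 * `|s| * normal_peak s / normal_peak (2 * s).
apply: (le_integrable measurableT _ _ (integrableZl measurableT K i2)).
  apply/measurable_EFinP; apply: measurable_funM; last exact: measurable_normal_pdf.
  by apply: measurableT_comp => //; apply: measurable_funB.
move=> y _ /=.
rewrite lee_fin [leLHS]normrM [leRHS]normrM normr_id (ger0_norm (normal_pdf_ge0 _ _ _))
  (ger0_norm (normal_pdf_ge0 _ _ _)).
rewrite !normal_pdfE//= /normal_fun.
have p0 := normal_peak_gt0 s0; have p1 := normal_peak_gt0 s20.
have K0 : 0 <= K by rewrite /K divr_ge0 ?mulr_ge0// ltW.
rewrite (ger0_norm K0).
have KE e : K * (normal_peak (2 * s) * e) = normal_peak s * (4 * `|s| * e).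
  by rewrite /K; field; rewrite gt_eqF.
rewrite KE mulrCA ler_pM2l//.
set z := y - m.
pose u := z ^+ 2 / (8 * s ^+ 2).
have u0 : 0 <= u by apply: divr_ge0; [exact: sqr_ge0 | apply: mulr_ge0 => //;
  exact: sqr_ge0].
have -> : - z ^+ 2 / (s ^+ 2 *+ 2) = - (4 * u) by rewrite /u; field; rewrite ?s0.
have -> : - z ^+ 2 / ((2 * s) ^+ 2 *+ 2) = - u by rewrite /u; field; rewrite ?s0.
have h1 : `|z| <= 4 * `|s| * expR u.
  apply: (@le_trans _ _ (4 * `|s| * (1 + u))); last first.
    by rewrite ler_wpM2l ?mulr_ge0// expR_ge1Dx.
  have -> : u = `|z| ^+ 2 / (8 * `|s| ^+ 2) by rewrite /u !real_normK ?num_real.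
  have s1 : 0 < `|s| by rewrite normr_gt0.
  have -> : 4 * `|s| * (1 + `|z| ^+ 2 / (8 * `|s| ^+ 2)) =
    4 * `|s| + `|z| ^+ 2 / (2 * `|s|).
    by field; rewrite gt_eqF.
  rewrite -subr_ge0.
  have -> : 4 * `|s| + `|z| ^+ 2 / (2 * `|s|) - `|z| =
    ((`|z| - `|s|) ^+ 2 + 7 * `|s| ^+ 2) / (2 * `|s|).
    by field; rewrite gt_eqF.
  apply: divr_ge0; last by apply: mulr_ge0.
  by apply: addr_ge0; [exact: sqr_ge0 | apply: mulr_ge0 => //; exact: sqr_ge0].
apply: (le_trans (ler_wpM2r (expR_ge0 _) h1)).
rewrite -(mulrA (4 * `|s|)) -expRD ler_wpM2l ?mulr_ge0// ler_expR; lra.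
Qed.

Lemma cvg_normal_pdf0 (m s : R) : s != 0 ->
  (fun n : nat => normal_pdf m s n%:R) @ \oo --> 0.
Proof.
move=> s0; rewrite normal_pdfE//=.
rewrite -[X in _ --> X](mulr0 (normal_peak s)); apply: cvgMr.
have c0 : 0 < Num.sqrt (s ^+ 2 *+ 2) by rewrite sqrtr_gt0 pmulrn_lgt0// exprn_even_gt0.
have -> : (fun n : nat => normal_fun m s n%:R) =
   gauss_fun \o (fun n : nat => (n%:R - m) / Num.sqrt (s ^+ 2 *+ 2)).
  apply/funext => n /=; rewrite /normal_fun /gauss_fun; congr expR.
  rewrite mulNr exprMn exprVn sqr_sqrtr// pmulrn_lge0// sqr_ge0//.
apply: cvg_comp; last exact: cvg_gauss_fun.
apply/cvgryPge => A.
exists (Num.truncn (A * Num.sqrt (s ^+ 2 *+ 2) + m)).+1 => // n /= hn.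
rewrite ler_pdivlMr// lerBrDr.
apply: ltW; apply: (lt_le_trans (truncnS_gt _)).
by rewrite ler_nat.
Qed.

Lemma integrable_bounded (h g : R -> R) :
  measurable_fun setT g -> mu.-integrable setT (EFin \o h) ->
  (forall y, `|g y| <= h y) -> mu.-integrable setT (EFin \o g).
Proof.
move=> mg ih gh; apply: (le_integrable measurableT _ _ ih).
  exact/measurable_EFinP.
by move=> y _ /=; rewrite lee_fin (le_trans (gh y))// ler_norm.
Qed.

(** Stein's identity: the derivative of [sin (t (y - m) + th)] times the density integrates to zero.
    It turns the derivative of the characteristic function into a multiple of that function. *)
Lemma Rintegral_sin_normal_pdf (m s t th : R) : s != 0 ->
  \int[mu]_y ((y - m) * sin (t * (y - m) + th) * normal_pdf m s y) =
  s ^+ 2 * t * \int[mu]_y (cos (t * (y - m) + th) * normal_pdf m s y).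
Proof.
move=> s0.
have maff : measurable_fun setT (fun y : R => t * (y - m) + th).
  by apply: measurable_funD => //; apply: measurable_funM => //; apply: measurable_funB.
have mc : measurable_fun setT (fun y : R => cos (t * (y - m) + th) : R).
  by apply: measurableT_comp => //; apply: continuous_measurable_fun; exact: continuous_cos.
have ms : measurable_fun setT (fun y : R => sin (t * (y - m) + th) : R).
  by apply: measurableT_comp => //; apply: continuous_measurable_fun; exact: continuous_sin.
have mN := measurable_normal_pdf m s.
have ic : mu.-integrable setT (EFin \o (fun y : R => cos (t * (y - m) + th) *
  normal_pdf m s y)).
  apply: (integrable_bounded (normal_pdf m s)); last 1 first.
  - by move=> y; rewrite normrM (ger0_norm (normal_pdf_ge0 _ _ _)) ler_piMl
      ?normal_pdf_ge0// ler_norml cos_geN1 cos_le1.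
  - exact: measurable_funM.
  - exact: integrable_normal_pdf.
have is_ : mu.-integrable setT (EFin \o (fun y : R => (y - m) * sin (t * (y - m) + th) *
  normal_pdf m s y)).
  apply: (integrable_bounded (fun y => `|y - m| * normal_pdf m s y)); last 1 first.
  - move=> y; rewrite !normrM (ger0_norm (normal_pdf_ge0 _ _ _)) ler_wpM2r
      ?normal_pdf_ge0//.
    by rewrite ler_piMr// ler_norml sin_geN1 sin_le1.
  - by apply: measurable_funM => //; apply: measurable_funM => //; apply: measurable_funB.
  - exact: integrable_center_normal_pdf.
have dF (y : R) : is_derive y (1 : R) (fun y : R => sin (t * (y - m) + th) *
  normal_pdf m s y)
   (t * (cos (t * (y - m) + th) * normal_pdf m s y) - (s ^+ 2)^-1 *
     ((y - m) * sin (t * (y - m) + th) * normal_pdf m s y)).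
  have dN := is_derive_normal_pdf m s s0 y.
  by apply: is_derive_eq; rewrite /GRing.scale/=; field.
have cN := @continuous_normal_pdf R m s s0.
have caff : continuous (fun y : R => t * (y - m) + th).
  move=> y; apply: cvgD; last exact: cvg_cst.
  by apply: cvgMr; apply: cvgB; [exact: cvg_id|exact: cvg_cst].
have hc : continuous (fun y : R => t * (cos (t * (y - m) + th) * normal_pdf m s y) -
  (s ^+ 2)^-1 * ((y - m) * sin (t * (y - m) + th) * normal_pdf m s y)).
  have cc : continuous (fun y : R => cos (t * (y - m) + th)).
    by move=> y; apply: continuous_comp; [exact: caff|exact: continuous_cos].
  have cs : continuous (fun y : R => sin (t * (y - m) + th)).
    by move=> y; apply: continuous_comp; [exact: caff|exact: continuous_sin].
  move=> y; apply: cvgB.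
    by apply: cvgMr; apply: cvgM; [exact: cc|exact: cN].
  apply: cvgMr; apply: cvgM; last exact: cN.
  by apply: cvgM; [apply: cvgB; [exact: cvg_id|exact: cvg_cst]|exact: cs].
have i1 := integrableZl measurableT t ic.
have i2 := integrableZl measurableT (s ^+ 2)^-1 is_.
have FN (y : R) : normal_pdf m s (- y) = normal_pdf (- m) s y.
  by rewrite !normal_pdfE//= /normal_fun opprK -opprD sqrrN.
have := integral_derive_eq0 _ _ dF hc _ _ _.
rewrite -[X in X = _]/(\int[mu]_x _)%E.
move=> /(_ (integrableB measurableT i1 i2)) H.
have {H} : (\int[mu]_x (t * (cos (t * (x - m) + th) * normal_pdf m s x) - (s ^+ 2)^-1 *
  ((x - m) * sin (t * (x - m) + th) * normal_pdf m s x))%:E)%E = 0%E.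
  apply: H.
  - apply/norm_cvg0P; apply: (squeeze_cvgr _ (cvg_cst 0) (cvg_normal_pdf0 m s s0)).
    apply: nearW => n; rewrite normr_ge0/= normrM (ger0_norm (normal_pdf_ge0 _ _ _))
      ler_piMl ?normal_pdf_ge0//.
    by rewrite ler_norml sin_geN1 sin_le1.
  - apply/norm_cvg0P; apply: (squeeze_cvgr _ (cvg_cst 0) (cvg_normal_pdf0 (- m) s s0)).
    apply: nearW => n; rewrite normr_ge0/= FN normrM (ger0_norm (normal_pdf_ge0 _ _ _))
      ler_piMl ?normal_pdf_ge0//.
    by rewrite ler_norml sin_geN1 sin_le1.
move=> /(congr1 fine); rewrite -[LHS]/(\int[mu]_x _) RintegralB// !RintegralZl// => /eqP.
rewrite subr_eq0 => /eqP /(congr1 (fun x => s ^+ 2 * x)).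
by rewrite !mulrA mulfV ?mul1r ?expf_neq0// => ->.
Qed.

Lemma integrable_cos_normal_pdf (m s t th : R) :
  mu.-integrable setT (EFin \o (fun y : R => cos (t * (y - m) + th) * normal_pdf m s y)).
Proof.
apply: (integrable_bounded (normal_pdf m s)); last 1 first.
- by move=> y; rewrite normrM (ger0_norm (normal_pdf_ge0 _ _ _)) ler_piMl
    ?normal_pdf_ge0// ler_norml cos_geN1 cos_le1.
- apply: measurable_funM; last exact: measurable_normal_pdf.
  apply: measurableT_comp; first by apply: continuous_measurable_fun; exact: continuous_cos.
  by apply: measurable_funD => //; apply: measurable_funM => //; apply: measurable_funB.
- exact: integrable_normal_pdf.
Qed.

Lemma is_derive_normal_cos (m s th : R) : s != 0 -> forall t : R,
  let J t := \int[mu]_y (cos (t * (y - m) + th) * normal_pdf m s y) in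
  is_derive t (1 : R) J (- (s ^+ 2 * t * J t)).
Proof.
move=> s0 t J.
pose f (t y : R) := cos (t * (y - m) + th) * normal_pdf m s y.
have df (u y : R) : is_derive u (1 : R) (f^~ y)
  (- ((y - m) * sin (u * (y - m) + th) * normal_pdf m s y)).
  by rewrite /f; apply: is_derive_eq; rewrite /GRing.scale/=; ring.
have d1 (u y : R) : partial1of2 f u y = - ((y - m) * sin (u * (y - m) + th) *
  normal_pdf m s y).
  by rewrite /partial1of2 derive1E derive_val.
have h1 : t \in `]t - 1, t + 1[ by rewrite in_itv/= ltrDl ltr01 andbT gtrBl.
have h2 x : `]t - 1, t + 1[%classic x -> mu.-integrable setT (EFin \o f x).
  by move=> _; exact: integrable_cos_normal_pdf.
have h3 x y : `]t - 1, t + 1[%classic x -> setT y -> derivable (f^~ y) x 1.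
  by move=> _ _; apply: ex_derive.
have h4 y : 0 <= `|y - m| * normal_pdf m s y by rewrite mulr_ge0// normal_pdf_ge0.
have h5 x y : `]t - 1, t + 1[%classic x -> setT y ->
    `|partial1of2 f x y| <= `|y - m| * normal_pdf m s y.
  move=> _ _; rewrite d1 normrN !normrM (ger0_norm (normal_pdf_ge0 _ _ _)).
  by rewrite ler_wpM2r ?normal_pdf_ge0// ler_piMr// ler_norml sin_geN1 sin_le1.
have := cvg_differentiation_under_integral measurableT h1 h2 h3 h4
  (integrable_center_normal_pdf m s s0) h5.
have -> : \int[mu]_y partial1of2 f t y = - (s ^+ 2 * t * J t).
  rewrite /J -Rintegral_sin_normal_pdf// -mulN1r -RintegralZl//.
    by apply: eq_Rintegral => y _; rewrite d1 mulN1r.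
  apply: (integrable_bounded (fun y => `|y - m| * normal_pdf m s y)); last 1 first.
  - move=> y; rewrite !normrM (ger0_norm (normal_pdf_ge0 _ _ _)) ler_wpM2r
      ?normal_pdf_ge0//.
    by rewrite ler_piMr// ler_norml sin_geN1 sin_le1.
  - apply: measurable_funM; last exact: measurable_normal_pdf.
    apply: measurable_funM; first by apply: measurable_funB.
    apply: measurableT_comp; first by apply: continuous_measurable_fun;
      exact: continuous_sin.
    by apply: measurable_funD => //; apply: measurable_funM => //; apply: measurable_funB.
  - exact: integrable_center_normal_pdf.
move=> H.
have {}H : h^-1 *: ((J \o shift t) (h *: 1) - J t) @[h --> 0^'] --> - (s ^+ 2 * t * J t).
  apply: cvg_trans H; apply: near_eq_cvg; near=> h.
  by rewrite /= /GRing.scale/= mulr1.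
apply: DeriveDef; first by apply/cvg_ex; eexists; exact: H.
exact: (cvg_lim _ H).
Unshelve. all: by end_near. Qed.

(** The integral solves [J' = - s ^+ 2 t J], so its product with [expR (s ^+ 2 t ^+ 2 / 2)] is
    constant in [t]; its value at 0 is the total mass times [cos th]. *)
Lemma Rintegral_normal_cos (m s t th : R) : s != 0 ->
  \int[mu]_y (cos (t * (y - m) + th) * normal_pdf m s y) =
  expR (- (s ^+ 2 * t ^+ 2 / 2)) * cos th.
Proof.
move=> s0.
pose J t := \int[mu]_y (cos (t * (y - m) + th) * normal_pdf m s y).
have dK (u : R) : is_derive u (1 : R) (fun u => J u * expR (s ^+ 2 * u ^+ 2 / 2)) 0.
  have dJ := is_derive_normal_cos m s th s0 u.
  rewrite -/J in dJ.
  by apply: is_derive_eq; rewrite /GRing.scale/=; field.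
have := is_derive_0_is_cst t 0 dK.
rewrite -/(J t) expr0n/= mulr0 mul0r expR0 mulr1.
have -> : J 0 = cos th.
  rewrite /J; under eq_Rintegral do rewrite mul0r add0r.
  rewrite RintegralZl//; last exact: integrable_normal_pdf.
  by rewrite /Rintegral integral_normal_pdf/= mulr1.
by move=> <-; rewrite [RHS]mulrC -[RHS]mulrA -expRD subrr expR0 mulr1.
Qed.
End Gaussian.

(** * The bivariate normal law and its characteristic function *)

Section BivariateGaussian.
Context {R : realType}.
Notation mu := (@lebesgue_measure R).

Lemma integral_normal_cos (m s t th : R) : s != 0 ->
  (\int[mu]_y (cos (t * (y - m) + th) * normal_pdf m s y)%:E =
  (expR (- (s ^+ 2 * t ^+ 2 / 2)) * cos th)%:E)%E.
Proof.
move=> s0; rewrite -(Rintegral_normal_cos m) // /Rintegral fineK//.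
exact: (integrable_fin_num _ (integrable_cos_normal_pdf m s t th)).
Qed.

(** Completing the square in [v.2]: the first marginal has variance [a], and the conditional law of
    the second coordinate has mean [b / a * v.1] and the Schur complement as variance. All bivariate
    integrals thereby reduce to iterated normal ones. *)
Lemma binormal_pdfE (a b c : R) : 0 < a -> 0 < a * c - b ^+ 2 ->
  forall v, binormal_pdf a b c v = normal_pdf 0 (Num.sqrt a) v.1 *
    normal_pdf (b / a * v.1) (Num.sqrt ((a * c - b ^+ 2) / a)) v.2.
Proof.
move=> a0; set D := _ - _ => D0 [x y] /=.
have Da0 : 0 < D / a by rewrite divr_gt0.
rewrite !normal_pdfE ?gt_eqF ?sqrtr_gt0//= /normal_fun /normal_peak !sqr_sqrtr ?ltW//.
rewrite mulrACA -expRD -invfM -sqrtrM; last by rewrite mulrn_wge0// mulr_ge0 ?pi_ge0 ?ltW.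
rewrite /binormal_pdf -/D /=; congr (_^-1 * expR _).
  have -> : a * pi *+ 2 * (D / a * pi *+ 2) = (2 * pi) ^+ 2 * D.
    by field; rewrite gt_eqF.
  by rewrite sqrtrM ?sqr_ge0// sqrtr_sqr ger0_norm// mulr_ge0// pi_ge0.
have DE : D = a * c - b ^+ 2 by [].
move: D0; rewrite /D => D0.
by field; rewrite !gt_eqF.
Qed.

Lemma binormal_pdf_ge0 (a b c : R) v : 0 <= binormal_pdf a b c v.
Proof.
by rewrite /binormal_pdf mulr_ge0 ?expR_ge0// invr_ge0 !mulr_ge0 ?pi_ge0 ?sqrtr_ge0.
Qed.

Lemma measurable_binormal_pdf (a b c : R) : measurable_fun setT (binormal_pdf a b c).
Proof.
rewrite /binormal_pdf; apply: measurable_funM => //.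
apply: measurableT_comp => //; apply: measurable_funM => //.
apply: measurableT_comp => //; apply: measurable_funD.
  apply: measurable_funB.
    by apply: measurable_funM => //; apply: measurable_funX; exact: measurable_fst.
  apply: measurable_funM; last exact: measurable_snd.
  by apply: measurable_funM => //; exact: measurable_fst.
by apply: measurable_funM => //; apply: measurable_funX; exact: measurable_snd.
Qed.

Let nu := (mu \x mu)%E.

Lemma integral_binormal_pdf (a b c : R) : 0 < a -> 0 < a * c - b ^+ 2 ->
  (\int[nu]_v (binormal_pdf a b c v)%:E = 1)%E.
Proof.
move=> a0 D0.
have := @fubini_tonelli1 _ _ _ _ R mu mu (EFin \o binormal_pdf a b c).
move=> ->; first last.
- by move=> v; rewrite lee_fin binormal_pdf_ge0.
- by apply/measurable_EFinP; exact: measurable_binormal_pdf.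
rewrite -[RHS](integral_normal_pdf 0 (Num.sqrt a)).
apply: eq_integral => x _; rewrite /fubini_F /=.
under eq_integral do rewrite binormal_pdfE// EFinM /=.
rewrite integralZl//; last exact: integrable_normal_pdf.
by rewrite integral_normal_pdf mule1.
Qed.

Lemma integrable_binormal_pdf (a b c : R) : 0 < a -> 0 < a * c - b ^+ 2 ->
  nu.-integrable setT (EFin \o binormal_pdf a b c).
Proof.
move=> a0 D0; apply/integrableP; split.
  by apply/measurable_EFinP; exact: measurable_binormal_pdf.
under eq_integral do rewrite /= ger0_norm ?binormal_pdf_ge0//.
by rewrite integral_binormal_pdf// ltry.
Qed.

Lemma integrable_bounded_binormal (a b c : R) (f : R * R -> R) (M : R) : 0 < a ->
  0 < a * c - b ^+ 2 ->
  measurable_fun setT f -> (forall v, `|f v| <= M) ->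
  nu.-integrable setT (fun v => (f v * binormal_pdf a b c v)%:E).
Proof.
move=> a0 D0 mf fM.
apply: (le_integrable measurableT _ _ (integrableZl measurableT M
  (integrable_binormal_pdf _ _ _ a0 D0))).
  by apply/measurable_EFinP; apply: measurable_funM => //; exact: measurable_binormal_pdf.
move=> v _ /=; rewrite lee_fin !normrM ler_wpM2r//.
by rewrite (le_trans (fM v))// ler_norm.
Qed.

Lemma measurable_cos2 (al be th : R) : measurable_fun setT
  (fun v : R * R => cos (al * v.1 + be * v.2 + th)).
Proof.
apply: measurableT_comp; first by apply: continuous_measurable_fun; exact: continuous_cos.
apply: measurable_funD => //; apply: measurable_funD; apply: measurable_funM => //.
Qed.

Lemma binormal_expect_cos (a b c al be th : R) : 0 < a -> 0 < a * c - b ^+ 2 ->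
  binormal_expect a b c (fun v => cos (al * v.1 + be * v.2 + th)) =
  expR (- ((a * al ^+ 2 + 2 * b * al * be + c * be ^+ 2) / 2)) * cos th.
Proof.
move=> a0 D0.
have Da0 : 0 < (a * c - b ^+ 2) / a by rewrite divr_gt0.
pose f := fun v : R * R => (cos (al * v.1 + be * v.2 + th) * binormal_pdf a b c v)%:E.
have intf : nu.-integrable setT f.
  apply: (@integrable_bounded_binormal _ _ _ _ 1) => //; first exact: measurable_cos2.
  by move=> v; rewrite ler_norml cos_geN1 cos_le1.
rewrite /binormal_expect -[X in fine X]/(\int[nu]_v f v)%E.
rewrite -(@integral12_prod_meas1 _ _ _ _ R mu mu f intf).
(* The inner integral yields the first exponential and moves its conditional mean into the frequency
   of [v.1], which becomes [al + be * b / a]; the outer integral yields the second. *)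
transitivity (fine (expR (- ((a * c - b ^+ 2) / a * be ^+ 2 / 2)) *
  (expR (- (a * (al + be * b / a) ^+ 2 / 2)) * cos th))%:E); last first.
  rewrite /= mulrA -expRD; congr (expR _ * _); field; by rewrite gt_eqF.
congr fine.
rewrite EFinM -[in RHS](sqr_sqrtr (ltW a0)) -(integral_normal_cos 0) ?gt_eqF ?sqrtr_gt0//.
rewrite -integralZl//; last exact: integrable_cos_normal_pdf.
apply: eq_integral => x _; rewrite /f /=.
transitivity (\int[mu]_y ((normal_pdf 0 (Num.sqrt a) x)%:E *
  (cos (be * (y - b / a * x) + ((al + be * b / a) * x + th)) *
   normal_pdf (b / a * x) (Num.sqrt ((a * c - b ^+ 2) / a)) y)%:E))%E.
  apply: eq_integral => y _; rewrite binormal_pdfE//= -EFinM mulrCA;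
    congr (_ * (cos _ * _))%:E.
  by field; rewrite gt_eqF.
rewrite integralZl//; last exact: integrable_cos_normal_pdf.
rewrite integral_normal_cos ?gt_eqF ?sqrtr_gt0// sqr_sqrtr ?ltW// -!EFinM subr0.
congr (_%:E); rewrite ?sqr_sqrtr ?ltW//; ring.
Qed.
End BivariateGaussian.

(** * Convergence criterion through characteristic functions *)

(* The mean of [g] under the binomial law with parameters [n] and [u]; as a
   function of [u] it is the Bernstein polynomial of [g]. *)
Fixpoint binomial_mean {R : realType} (n : nat) (u : R) (g : nat -> R) : R :=
  if n is n'.+1 then
    (1 - u) * binomial_mean n' u g + u * binomial_mean n' u (g \o succn)
  else g 0%N.

(** * Bernstein approximation on the unit square *)

Section Bernstein.
Context {R : realType}.
Implicit Types (u : R) (g h : nat -> R).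

Lemma eq_binomial_mean n u g h : g =1 h -> binomial_mean n u g = binomial_mean n u h.
Proof.
elim: n g h => [|n IH] g h gh //=.
by rewrite (IH _ _ gh) (IH (g \o succn) (h \o succn)) // => i /=; rewrite gh.
Qed.

Lemma binomial_meanD n u g h (k : R) :
  binomial_mean n u (fun i => k * g i + h i) = k * binomial_mean n u g +
    binomial_mean n u h.
Proof.
elim: n g h => [|n IH] g h //=.
rewrite IH (IH (g \o succn) (h \o succn)); ring.
Qed.

Lemma binomial_mean_cst n u (k : R) : binomial_mean n u (fun=> k) = k.
Proof. by elim: n => [|n IH] //=; rewrite IH; ring. Qed.

Lemma le_binomial_mean n u g h : 0 <= u <= 1 -> (forall i, g i <= h i) ->
  binomial_mean n u g <= binomial_mean n u h.
Proof.
move=> /andP[u0 u1]; elim: n g h => [|n IH] g h gh //=.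
by apply: lerD; apply: ler_wpM2l; rewrite ?subr_ge0//; apply: IH => i; exact: gh.
Qed.

(** The offset [x] makes the induction close: conditioning on one trial replaces it by [x - u] or
    [x + 1 - u]. *)
Lemma binomial_mean_variance n u (x : R) :
  binomial_mean n u (fun i => (i%:R - n%:R * u + x) ^+ 2) = n%:R * u * (1 - u) + x ^+ 2.
Proof.
elim: n x => [|n IH] x /=; first by rewrite !mul0r subr0 add0r add0r.
rewrite (eq_binomial_mean _ _ _ (fun i => (i%:R - n%:R * u + (x - u)) ^+ 2)); last first.
  by move=> i; rewrite -natr1; ring.
rewrite IH (eq_binomial_mean _ _ _ (fun i => (i%:R - n%:R * u + (x + 1 - u)) ^+ 2));
  last first.
  by move=> i /=; rewrite -!natr1; ring.
rewrite IH -natr1; ring.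
Qed.

Lemma binomial_mean_dist n u : (0 < n)%N -> 0 <= u <= 1 ->
  binomial_mean n u (fun i => (u - i%:R / n%:R) ^+ 2) <= n%:R^-1.
Proof.
move=> n0 /andP[u0 u1]; have n0' : 0 < n%:R :> R by rewrite ltr0n.
rewrite (eq_binomial_mean _ _ _ (fun i => n%:R^-2 * (i%:R - n%:R * u + 0) ^+ 2 + 0));
  last first.
  by move=> i; field; rewrite gt_eqF.
rewrite binomial_meanD binomial_mean_cst binomial_mean_variance.
have -> : n%:R^-2 * (n%:R * u * (1 - u) + 0 ^+ 2) + 0 = (u * (1 - u)) / n%:R.
  by field; rewrite gt_eqF.
rewrite ler_piMl ?invr_ge0 ?ltW//; nra.
Qed.

(** Bernstein's proof by Chebyshev's inequality. Only [(x, y)] is confined to the unit square in the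
    continuity hypothesis, because [le_binomial_mean] asks for a bound at every index, also beyond
    [n], where the grid point leaves the square. *)
Lemma bernstein_approx2 (F : R -> R -> R) (M e d : R) : 0 < e -> 0 < d ->
  (forall x y, `|F x y| <= M) ->
  (forall x y x' y', 0 <= x <= 1 -> 0 <= y <= 1 -> `|x - x'| < d -> `|y - y'| < d ->
    `|F x y - F x' y'| <= e) ->
  exists2 n, (0 < n)%N & forall x y, 0 <= x <= 1 -> 0 <= y <= 1 ->
   `|F x y - binomial_mean n x (fun i => binomial_mean n y
     (fun j => F (i%:R / n%:R) (j%:R / n%:R)))| <= 2 * e.
Proof.
move=> e0 d0 FM uF.
have M0 : 0 <= M by apply: le_trans (FM 0 0).
pose K := 2 * M / d ^+ 2.
have K0 : 0 <= K by apply: divr_ge0; [exact: mulr_ge0 | exact: sqr_ge0].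
have [n n0 nK] : exists2 n, (0 < n)%N & 2 * K / n%:R <= e.
  exists (Num.truncn (2 * K / e)).+1 => //.
  by rewrite ler_pdivrMr// (mulrC e) -ler_pdivrMr//; apply: ltW; exact: truncnS_gt.
exists n => // x y hx hy.
(* When either coordinate is off by at least [d], the choice of [K] makes the quadratic term exceed
   the trivial bound [2 * M]. Averaging this bound gives at most [e + 2 * K / n]. *)
have pt i j : `|F x y - F (i%:R / n%:R) (j%:R / n%:R)| <=
   e + K * ((x - i%:R / n%:R) ^+ 2 + (y - j%:R / n%:R) ^+ 2).
  set x' := i%:R / _; set y' := j%:R / _.
  have F2 : `|F x y - F x' y'| <= 2 * M.
    by rewrite (le_trans (ler_normB _ _))// mulr_natl mulr2n lerD.
  have aux (z z' : R) : d <= `|z - z'| -> 2 * M <= K * (z - z') ^+ 2.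
    move=> dz; have : d ^+ 2 <= (z - z') ^+ 2
      by rewrite -[leRHS]real_normK ?num_real// lerXn2r// nnegrE ltW.
    move=> h; rewrite /K mulrAC ler_pdivlMr ?exprn_gt0//; apply: ler_wpM2l => //;
      exact: mulr_ge0.
  have sx := sqr_ge0 (x - x'); have sy := sqr_ge0 (y - y').
  case: (ltP `|x - x'| d) => h1; last by have := aux _ _ h1; nra.
  case: (ltP `|y - y'| d) => h2; last by have := aux _ _ h2; nra.
  have := uF _ _ _ _ hx hy h1 h2; nra.
have up : binomial_mean n x (fun i => binomial_mean n y (fun j => e +
  K * ((x - i%:R / n%:R) ^+ 2 + (y - j%:R / n%:R) ^+ 2))) <= 2 * e.
  rewrite (eq_binomial_mean _ _ _ (fun i => K * (x - i%:R / n%:R) ^+ 2 +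
    (e + K * binomial_mean n y (fun j => (y - j%:R / n%:R) ^+ 2)))); last first.
    move=> i; rewrite (eq_binomial_mean _ _ _ (fun j => K * (y - j%:R / n%:R) ^+ 2 +
      (e + K * (x - i%:R / n%:R) ^+ 2))); last by move=> j; ring.
    rewrite binomial_meanD binomial_mean_cst; ring.
  rewrite binomial_meanD binomial_mean_cst.
  have h1 := ler_wpM2l K0 (binomial_mean_dist n x n0 hx).
  have h2 := ler_wpM2l K0 (binomial_mean_dist n y n0 hy).
  have : 2 * K / n%:R = K * n%:R^-1 + K * n%:R^-1 by ring.
  lra.
have DE s : s * F x y - s * binomial_mean n x
  (fun i => binomial_mean n y (fun j => F (i%:R / n%:R) (j%:R / n%:R))) =
   binomial_mean n x (fun i => binomial_mean n y
     (fun j => s * (F x y - F (i%:R / n%:R) (j%:R / n%:R)))).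
  rewrite [RHS](eq_binomial_mean _ _ _ (fun i => (- s) *
    binomial_mean n y (fun j => F (i%:R / n%:R) (j%:R / n%:R)) + s * F x y)); last first.
    move=> i; rewrite (eq_binomial_mean _ _ _
      (fun j => (- s) * F (i%:R / n%:R) (j%:R / n%:R) + s * F x y)); last by move=> j; ring.
    by rewrite binomial_meanD binomial_mean_cst.
  by rewrite [RHS]binomial_meanD binomial_mean_cst; ring.
have bd s : `|s| = 1 -> s * F x y - s * binomial_mean n x
  (fun i => binomial_mean n y (fun j => F (i%:R / n%:R) (j%:R / n%:R))) <= 2 * e.
  move=> s1; rewrite DE; apply: le_trans up.
  apply: le_binomial_mean => // i; apply: le_binomial_mean => // j.
  by rewrite (le_trans (ler_norm _))// normrM s1 mul1r.
have b1 := bd 1 (normr1 _); have b2 := bd (-1) (normrN1 _).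
by rewrite ler_norml; apply/andP; split; lra.
Qed.
End Bernstein.

(** * Uniform continuity and a clamped arcsine *)

Section Heine.
Context {R : realType}.
Lemma heine_cantor_unit_square (G : R * R -> R) (e : R) : continuous G -> 0 < e ->
  exists2 d : R, 0 < d & forall x y x' y', 0 <= x <= 1 -> 0 <= y <= 1 ->
    `|x - x'| < d -> `|y - y'| < d -> `|G (x, y) - G (x', y')| <= e.
Proof.
move=> cG e0.
pose P (d : R) (p : R * R) := forall q : R * R, `|p.1 - q.1| < d -> `|p.2 - q.2| < d ->
  `|G p - G q| <= e.
have cK : compact ((`[0, 1] : set R) `*` (`[0, 1] : set R)).
  by apply: compact_setX; exact: segment_compact.
have /(_ R 0^'+ P _) := (compact_near_coveringP _).1 cK.
case.
  move=> p _.
  have e2 : 0 < e / 2 by rewrite divr_gt0.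
  have /cvgrPdist_lt /(_ _ e2) /nbhs_ballP[r r0 hr] := cG p.
  have r2 : 0 < r / 2 by rewrite divr_gt0.
  (* Half radii: [p'] lies within [r / 2] of [p] and [q] within [d < r / 2] of [p'], so both stay in
     the ball of radius [r] where [G] varies by less than [e / 2] from [G p]. *)
  exists (ball p (r / 2), [set d | d < r / 2]).
    by split; [exact: nbhsx_ballx | exact: nbhs_right_lt].
  move=> [p' d] /= [[b1 b2] dr] q q1 q2.
  rewrite /ball/= in b1 b2.
  have h1 : `|G p - G p'| < e / 2.
    apply: hr; split; rewrite /ball/=; lra.
  have h2 : `|G p - G q| < e / 2.
    apply: hr; split; rewrite /ball/=.
      by rewrite -(subrKA p'.1) (le_lt_trans (ler_normD _ _))//; lra.
    by rewrite -(subrKA p'.2) (le_lt_trans (ler_normD _ _))//; lra.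
  rewrite -(subrKA (G p)) (le_trans (ler_normD _ _))// [`|G p' - _|]distrC; lra.
move=> r r0 hr; exists (r / 2); first by rewrite divr_gt0.
move=> x y x' y' hx hy dx dy.
apply: (hr (r / 2) _ _ (x, y) _ (x', y')) => //=.
- by rewrite sub0r normrN gtr0_norm ?divr_gt0// ltr_pdivrMr// ltr_pMr// ltr1n.
- by rewrite divr_gt0.
Qed.

(* A continuous left inverse of [sin] on [-1/2, 1/2], defined on the whole line. *)
Definition arcsine_half (z : R) : R :=
  asin (Num.max (- sin 2^-1) (Num.min z (sin 2^-1))).
(** Strictness keeps the clamped argument of [asin] inside the open interval [(-1, 1)], where [asin]
    is known to be continuous. *)
Lemma sin_half_lt1 : (0 : R) < sin (2^-1 : R) < 1.
Proof.
have := @pihalf_ge1 R => hp.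
have h : (2^-1 : R) < pi / 2 by lra.
apply/andP; split; first by apply: sin_gt0_pihalf; apply/andP; split => //; lra.
rewrite -[X in _ < X](sin_pihalf R) ltr_sin// in_itv/=; lra.
Qed.

Lemma continuous_arcsine_half : continuous arcsine_half.
Proof.
move=> z; have /andP[s0 s1] := sin_half_lt1.
apply: (@continuous_comp _ _ _ (fun z => Num.max (- sin 2^-1) (Num.min z (sin 2^-1))) asin).
  apply: continuous_max; first exact: cvg_cst.
  apply: continuous_min; [exact: cvg_id|exact: cvg_cst].
apply: continuous_asin; apply/andP; split.
  by rewrite lt_max ltrN2 s1.
by rewrite gt_max gt_min s1 orbT andbT; lra.
Qed.

Lemma arcsine_halfK (t : R) : `|t| <= 2^-1 -> arcsine_half (sin t) = t.
Proof.
rewrite ler_norml => /andP[t0 t1]; have := @pihalf_ge1 R => hp.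
have i1 : 2^-1 \in `[- (pi / 2), (pi / 2 : R)] by rewrite in_itv/=; lra.
have i2 : - 2^-1 \in `[- (pi / 2), (pi / 2 : R)] by rewrite in_itv/=; lra.
have i3 : t \in `[- (pi / 2), (pi / 2 : R)] by rewrite in_itv/=; lra.
have h1 : sin t <= sin 2^-1 by rewrite leNgt ltr_sin// -leNgt.
have h2 : - sin 2^-1 <= sin t by rewrite -sinN leNgt ltr_sin// -leNgt.
by rewrite /arcsine_half (min_idPl h1) (max_idPr h2) sinK.
Qed.
End Heine.

(** * From characteristic functions to weak convergence, for positive normalized linear
    functionals *)

Section Criterion.
Context {R : realType}.
Variables (E : nat -> (R * R -> R) -> R) (a b c B : R).
Hypothesis a0 : 0 < a.
Hypothesis D0 : 0 < a * c - b ^+ 2.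
Hypothesis ElinE : forall n k f g, E n (fun v => k * f v + g v) = k * E n f + E n g.
Hypothesis Ele : forall n f g, (forall v, f v <= g v) -> E n f <= E n g.
Hypothesis E1 : forall n, E n (fun=> 1) = 1.
Hypothesis Etight : forall n, E n (fun v => v.1 ^+ 2 + v.2 ^+ 2) <= B.
Hypothesis Ecf : forall al be th,
  (fun n => E n (fun v => cos (al * v.1 + be * v.2 + th))) @ \oo -->
  expR (- ((a * al ^+ 2 + 2 * b * al * be + c * be ^+ 2) / 2)) * cos th.

Notation EN := (binormal_expect a b c).
Let nu := (@lebesgue_measure R \x @lebesgue_measure R)%E.
Let bm (h : R * R -> R) := measurable_fun setT h /\ exists M, forall v, `|h v| <= M.

Let int_bm h : bm h -> nu.-integrable setT (fun v => (h v * binormal_pdf a b c v)%:E).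
Proof. by move=> [mh [M hM]]; exact: (integrable_bounded_binormal _ _ _ _ M). Qed.

Let bm_lin k f g : bm f -> bm g -> bm (fun v => k * f v + g v).
Proof.
move=> [mf [M fM]] [mg [N gN]]; split.
  by apply: measurable_funD => //; exact: measurable_funM.
exists (`|k| * M + N) => v; rewrite (le_trans (ler_normD _ _))// lerD// normrM.
exact: ler_wpM2l.
Qed.

Let EN_lin k f g : bm f -> bm g -> EN (fun v => k * f v + g v) = k * EN f + EN g.
Proof.
move=> bf bg; rewrite /binormal_expect.
have i1 := int_bm _ bf; have i2 := int_bm _ bg.
have i3 := integrableZl measurableT k i1.
transitivity (fine (k%:E * (\int[nu]_v (f v * binormal_pdf a b c v)%:E) +
  \int[nu]_v (g v * binormal_pdf a b c v)%:E)%E).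
  congr fine; rewrite -integralZl// -integralD//.
  by apply: eq_integral => v _; rewrite -EFinM -EFinD; congr (_%:E); ring.
rewrite fineD ?fineM//; [exact: integrable_fin_num|rewrite fin_numM//|];
  exact: integrable_fin_num.
Qed.

Let EN_le f g (e : R) : bm f -> bm g -> (forall v, `|f v - g v| <= e) -> `|EN f - EN g| <=
  e.
Proof.
move=> bf bg fg.
have -> : EN f - EN g = EN (fun v => (-1) * g v + f v) by rewrite EN_lin//; ring.
have bfg := bm_lin (-1) _ _ bg bf.
have ib := int_bm _ bfg.
rewrite /binormal_expect -lee_fin.
have -> : (`|fine (\int[nu]_v (((-1) * g v + f v) * binormal_pdf a b c v)%:E)%E|%:E =
  `|\int[nu]_v (((-1) * g v + f v) * binormal_pdf a b c v)%:E|)%E.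
  by rewrite -abse_EFin fineK//; exact: integrable_fin_num.
apply: (le_trans (le_abse_integral _ _ _)) => //; first by case/integrableP: ib.
apply: (@le_trans _ _ (\int[nu]_v (e%:E * (binormal_pdf a b c v)%:E))%E).
  apply: ge0_le_integral => //.
  - by apply: measurableT_comp => //; case/integrableP: ib.
  - apply: emeasurable_funM => //; apply/measurable_EFinP; exact: measurable_binormal_pdf.
  - move=> v _; rewrite -EFinM lee_fin normrM (ger0_norm (binormal_pdf_ge0 _ _ _ _)).
    by rewrite ler_wpM2r ?binormal_pdf_ge0// mulN1r addrC.
rewrite integralZl//; last exact: integrable_binormal_pdf.
by rewrite integral_binormal_pdf// mule1.
Qed.

Let conv h := bm h /\ (fun n => E n h) @ \oo --> EN h.

Let conv_lin k f g : conv f -> conv g -> conv (fun v => k * f v + g v).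
Proof.
move=> [bf cf] [bg cg]; split; first exact: bm_lin.
rewrite EN_lin//; under eq_fun do rewrite ElinE.
by apply: cvgD => //; exact: cvgMr.
Qed.

Let Ecst n (k : R) : E n (fun=> k) = k.
Proof.
have E0 : E n (fun=> 0) = 0.
  have := ElinE n 1 (fun=> 0) (fun=> 0).
  have -> : (fun v : R * R => 1 * (0 : R) + 0) = (fun=> 0) by apply/funext => v; ring.
  lra.
have := ElinE n k (fun=> 1) (fun=> 0).
have -> : (fun v : R * R => k * (1 : R) + 0) = (fun=> k) by apply/funext => v; ring.
by rewrite E1 E0 => ->; ring.
Qed.

Let E_le n f g h : (forall v, `|f v - g v| <= h v) -> `|E n f - E n g| <= E n h.
Proof.
move=> fg.
have EN1 k : k * E n f - k * E n g = E n (fun v => k * f v + ((- k) * g v + 0)).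
  by rewrite ElinE ElinE Ecst; ring.
have b1 : E n f - E n g <= E n h.
  have := EN1 1; rewrite !mul1r => ->; apply: Ele => v.
  by have := fg v; rewrite ler_norml; lra.
have b2 : E n g - E n f <= E n h.
  have := EN1 (-1); rewrite !mulN1r opprK addrC => ->; apply: Ele => v.
  by have := fg v; rewrite ler_norml; lra.
by rewrite ler_norml; apply/andP; split; lra.
Qed.

Let conv_unif f : (exists M, forall v, `|f v| <= M) ->
  (forall e, 0 < e -> exists2 g, conv g & forall v, `|f v - g v| <= e) -> conv f.
Proof.
move=> fM H.
(* Measurability is not assumed: [f] is the pointwise limit of convergent, hence measurable,
   approximants with errors [1 / (n + 1)]. *)
have mf : measurable_fun setT f.
  have /choice[g Hg] : forall n : nat, exists g, conv g /\ forall v, `|f v - g v| <=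
    n.+1%:R^-1.
    by move=> n; have [g cg fg] := H n.+1%:R^-1 ltac:(by rewrite invr_gt0); exists g.
  apply: (@measurable_fun_cvg _ _ _ _ g).
    by move=> n; case: (Hg n) => [[[]]].
  move=> v _; apply/cvgrPdist_le => e e0.
  near=> n; rewrite (le_trans ((Hg n).2 v))//.
  near: n; have /cvgrPdist_le /(_ _ e0) := @cvg_harmonic R.
  by apply: filterS => n /=; rewrite sub0r normrN ger0_norm ?invr_ge0//.
split => //; apply/cvgrPdist_le => e e0.
have e3 : 0 < e / 3 by rewrite divr_gt0.
have [g [bg cg] fg] := H _ e3.
have EfEg := EN_le _ _ _ (conj mf fM) bg fg.
have /cvgrPdist_le /(_ _ e3) := cg.
apply: filterS => n hn.
have h2 : `|E n f - E n g| <= e / 3.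
  by rewrite -[leRHS](Ecst n); apply: E_le.
move: EfEg hn h2; rewrite !ler_norml => /andP[? ?] /andP[? ?] /andP[? ?]; apply/andP;
  split; lra.
Unshelve. all: end_near. Qed.

(* Multiplication by a sine shifts the frequencies of the cosine, so this class
   is stable under multiplication by sines, which [conv] is not a priori. *)
Let good h := forall al be th, conv (fun v => h v * cos (al * v.1 + be * v.2 + th)).

Let good_lin k f g : good f -> good g -> good (fun v => k * f v + g v).
Proof.
move=> gf gg al be th.
have -> : (fun v => (k * f v + g v) * cos (al * v.1 + be * v.2 + th)) =
  (fun v => k * (f v * cos (al * v.1 + be * v.2 + th)) +
    g v * cos (al * v.1 + be * v.2 + th)).
  by apply/funext => v; ring.
exact: conv_lin.
Qed.

Let good_cst k : good (fun=> k).
Proof.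
have good1 : good (fun=> 1).
  move=> al be th.
  have -> : (fun v => 1 * cos (al * v.1 + be * v.2 + th)) =
    (fun v => cos (al * v.1 + be * v.2 + th)).
    by apply/funext => v; rewrite mul1r.
  split; last by rewrite binormal_expect_cos.
  split; first exact: measurable_cos2.
  by exists 1 => v; rewrite ler_norml cos_geN1 cos_le1.
have := good_lin (k - 1) _ _ good1 good1.
by congr good; apply/funext => v; ring.
Qed.

(** Product-to-sum formula: the product of a sine and a cosine is half the sum of two sines, and
    shifting the phase by [- pi / 2] makes them cosines again. Arbitrary phases in [good] are needed
    for this. *)
Let good_sin h p q : good h -> good (fun v => sin (p * v.1 + q * v.2) * h v).
Proof.
move=> gh al be th.
have H s v : cos ((p + s * al) * v.1 + (q + s * be) * v.2 + (s * th - pi / 2)) =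
   sin (p * v.1 + q * v.2 + s * (al * v.1 + be * v.2 + th)) :> R.
  by rewrite -cosBpihalf; congr cos; ring.
have := conv_lin 2^-1 _ _ (gh (p + 1 * al) (q + 1 * be) (1 * th - pi / 2))
  (conv_lin 2^-1 _ _ (gh (p + (-1) * al) (q + (-1) * be) ((-1) * th - pi / 2))
    (good_cst 0 0 0 0)).
congr conv; apply/funext => v; by rewrite !H mul1r mulN1r sinD sinB; field.
Qed.

Let good_mean n p q (H : nat -> R * R -> R) : (forall i, good (H i)) ->
  good (fun v => binomial_mean n ((1 + sin (p * v.1 + q * v.2)) / 2) (H^~ v)).
Proof.
elim: n H => [|n IH] H gH; first exact: gH.
have g1 := IH _ gH; have g2 := IH (fun i => H i.+1) (fun i => gH i.+1).
have := good_lin 2^-1 _ _ g1 (good_lin (- 2^-1) _ _ (good_sin _ p q g1)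
  (good_lin 2^-1 _ _ g2 (good_lin 2^-1 _ _ (good_sin _ p q g2) (good_cst 0)))).
congr good; apply/funext => v /=.
by rewrite -[(_ \o succn)]/(fun i => H i.+1 v); field.
Qed.

Let good_conv h : good h -> conv h.
Proof.
move=> /(_ 0 0 0); congr conv; apply/funext => v.
by rewrite !mul0r !add0r cos0 mulr1.
Qed.

(** The substitution [p = (1 + sin) / 2] sends both sines to the unit square, where [G] is the
    function to approximate. Its Bernstein polynomials become polynomials in sines, which
    [good_mean], applied once per variable, places among the convergent functions. *)
Let conv_box (f : R * R -> R) M (L p0 : R) : continuous f -> (forall v, `|f v| <= M) ->
  conv (fun v => f (L * arcsine_half (sin (p0 * v.1)), L * arcsine_half (sin (p0 * v.2)))).
Proof.
move=> cf fM; apply: conv_unif; first by exists M => v.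
move=> e e0; have e2 : 0 < e / 2 by rewrite divr_gt0.
pose G (p : R * R) := f (L * arcsine_half (2 * p.1 - 1), L * arcsine_half (2 * p.2 - 1)).
have cG : continuous G.
  have ca (pr : R * R -> R) : continuous pr ->
    continuous (fun p => L * arcsine_half (2 * pr p - 1)).
    move=> cpr p; apply: cvgMr; apply: continuous_comp; last exact: continuous_arcsine_half.
    by apply: cvgB; [apply: cvgMr; exact: cpr | exact: cvg_cst].
  have c1 : continuous (fun p : R * R => L * arcsine_half (2 * p.1 - 1)).
    by apply: (ca fst) => p; exact: cvg_fst.
  have c2 : continuous (fun p : R * R => L * arcsine_half (2 * p.2 - 1)).
    by apply: (ca snd) => p; exact: cvg_snd.
  move=> p; apply: (@continuous_comp _ _ _ (fun p : R *
    R => (L * arcsine_half (2 * p.1 - 1), L * arcsine_half (2 * p.2 - 1))) f);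
      last exact: cf.
  exact: (cvg_pair (c1 p) (c2 p)).
have [d d0 uG] := heine_cantor_unit_square G _ cG e2.
have [n n0 Hn] := bernstein_approx2 (fun x y => G (x, y)) M _ _ e2 d0 (fun x y => fM _) uG.
exists (fun v => binomial_mean n ((1 + sin (p0 * v.1 + 0 * v.2)) / 2) (fun i =>
   binomial_mean n ((1 + sin (0 * v.1 + p0 * v.2)) / 2)
     (fun j => G (i%:R / n%:R, j%:R / n%:R)))).
  apply: good_conv; apply: (good_mean n (p0) 0
    (fun i v => binomial_mean n ((1 + sin (0 * v.1 + p0 * v.2)) / 2)
      (fun j => G (i%:R / n%:R, j%:R / n%:R)))) => i.
  apply: (good_mean n 0 (p0) (fun j _ => G (i%:R / n%:R, j%:R / n%:R))) => j.
  exact: good_cst.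
move=> v; rewrite !mul0r addr0 add0r.
have u01 (z : R) : 0 <= (1 + sin z) / 2 <= 1 by have := sin_geN1 z; have := sin_le1 z; lra.
have uE (z : R) : 2 * ((1 + sin z) / 2) - 1 = sin z by field.
have := Hn _ _ (u01 (p0 * v.1)) (u01 (p0 * v.2)).
by rewrite {1}/G /= !uE => /le_trans; apply; rewrite mulrC divfK.
Qed.

Theorem cvg_dist_of_cf : cvg_dist_binormal E a b c.
Proof.
move=> f cf [M fM].
(* The scale [1 / (2 (l + 1))] keeps the argument of each sine in [[-1/2, 1/2]] on the square of
   half-side [l + 1]; there [arcsine_half] undoes the sine and [g l] equals [f]. *)
pose g (l : nat) v := f (2 * l.+1%:R * arcsine_half (sin (l.+1%:R^-1 / 2 * v.1)),
  2 * l.+1%:R * arcsine_half (sin (l.+1%:R^-1 / 2 * v.2))).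
have cg l : conv (g l) by apply: (conv_box _ M).
have M0 : 0 <= M by apply: le_trans (fM (0, 0)).
have gM l v : `|g l v| <= M by apply: fM.
have gE l (v : R * R) : `|v.1| <= l.+1%:R -> `|v.2| <= l.+1%:R -> g l v = f v.
  move=> h1 h2; rewrite /g !arcsine_halfK.
  - by case: v h1 h2 => x y _ _ /=; congr (f (_, _)); field.
  - by rewrite mulrAC normrM (ger0_norm (_ : 0 <= 2^-1))// ler_piMl// mulrC normrM normfV
      (ger0_norm (ler0n _ _)) ler_pdivrMr// mul1r.
  - by rewrite mulrAC normrM (ger0_norm (_ : 0 <= 2^-1))// ler_piMl// mulrC normrM normfV
      (ger0_norm (ler0n _ _)) ler_pdivrMr// mul1r.
have gcvg v : g ^~ v @ \oo --> f v.
  apply: cvg_near_cst.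
  exists (Num.truncn (`|v.1| + `|v.2|)).+1 => // l /= hl.
  have h : `|v.1| + `|v.2| <= l.+1%:R.
    by apply: ltW; apply: (lt_le_trans (truncnS_gt _)); rewrite ler_nat (leq_trans hl).
  by apply: gE; apply: le_trans h; rewrite ?lerDl ?lerDr.
have mf : measurable_fun setT f.
  apply: (@measurable_fun_cvg _ _ _ _ g); last by move=> v _; exact: gcvg.
  by move=> l; case: (cg l) => [[]].
have bf : bm f by split => //; exists M.
(* On the Gaussian side dominated convergence suffices to pass from [g l] to [f]; the second moments
   are used for [E n] only, where uniformity in [n] is required. *)
have ENg : (fun l => EN (g l)) @ \oo --> EN f.
  apply: fine_cvg; rewrite fineK; last exact: integrable_fin_num (int_bm _ bf).
  apply: (@dominated_cvg _ _ _ nu _ measurableT _ _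
    (fun v => (M * binormal_pdf a b c v)%:E)) => //.
  - by move=> l; case/integrableP: (int_bm _ (cg l).1).
  - move=> v _; apply: cvg_EFin; first exact: nearW.
    exact: cvgMl (gcvg v).
  - exact: (integrableZl measurableT M (integrable_binormal_pdf _ _ _ a0 D0)).
  - move=> l v _; rewrite lee_fin normrM (ger0_norm (binormal_pdf_ge0 _ _ _ _)).
    by rewrite ler_wpM2r ?binormal_pdf_ge0.
apply/cvgrPdist_le => e e0; have e3 : 0 < e / 3 by rewrite divr_gt0.
have K0 : 0 <= 2 * M * B.
  apply: mulr_ge0; first exact: mulr_ge0.
  apply: le_trans (Etight 0); rewrite -(Ecst 0 0); apply: Ele => v.
  by apply: addr_ge0; exact: sqr_ge0.
near \oo => l.
have h1 : `|EN f - EN (g l)| <= e / 3.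
  by near: l; move/cvgrPdist_le : ENg => /(_ _ e3).
have h2 : 2 * M * B / l.+1%:R <= e / 3.
  rewrite ler_pdivrMr// (mulrC (e / 3)) -ler_pdivrMr//.
  near: l; exists (Num.truncn (2 * M * B / (e / 3))).+1 => // l /= hl.
  by apply: ltW; apply: (lt_le_trans (truncnS_gt _)); rewrite ler_nat (leq_trans hl).
have h3 n : `|E n f - E n (g l)| <= e / 3.
  apply: le_trans h2.
  have l0 : 0 < l.+1%:R :> R by [].
  have l1 : 1 <= l.+1%:R :> R by rewrite ler1n.
  (* Chebyshev: outside the square some squared coordinate exceeds [(l + 1) ^+ 2], hence also
     [l + 1], and [|f - g l| <= 2 * M]; inside, the difference vanishes. *)
  apply: (@le_trans _ _ (E n (fun v => 2 * M / l.+1%:R * (v.1 ^+ 2 + v.2 ^+ 2) + 0))).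
    apply: E_le => v; rewrite addr0.
    have sx := sqr_ge0 v.1; have sy := sqr_ge0 v.2.
    have F2 : `|f v - g l v| <= 2 * M.
      by rewrite (le_trans (ler_normB _ _))// mulr_natl mulr2n lerD.
    have aux (z : R) : l.+1%:R < `|z| -> z ^+ 2 <= v.1 ^+ 2 + v.2 ^+ 2 ->
        `|f v - g l v| <= 2 * M / l.+1%:R * (v.1 ^+ 2 + v.2 ^+ 2).
      move=> hz zv; apply: (le_trans F2).
      rewrite mulrAC ler_pdivlMr//; apply: ler_wpM2l; first exact: mulr_ge0.
      have : l.+1%:R ^+ 2 <= z ^+ 2 by rewrite -[leRHS]real_normK ?num_real// lerXn2r//
        ?nnegrE// ltW.
      nra.
    have [hx|hx] := lerP `|v.1| l.+1%:R; last by apply: (aux _ hx); rewrite lerDl.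
    have [hy|hy] := lerP `|v.2| l.+1%:R; last by apply: (aux _ hy); rewrite lerDr.
    rewrite gE// subrr normr0; apply: mulr_ge0; last exact: addr_ge0.
    by apply: divr_ge0 => //; exact: mulr_ge0.
  rewrite ElinE Ecst addr0 mulrAC ler_wpM2r ?invr_ge0//.
  by apply: ler_wpM2l => //; exact: mulr_ge0.
have /cvgrPdist_le /(_ _ e3) := (cg l).2.
apply: filterS => n hn.
move: h1 hn (h3 n); rewrite !ler_norml => /andP[? ?] /andP[? ?] /andP[? ?]; apply/andP;
  split; lra.
Unshelve. all: end_near. Qed.
End Criterion.

(** * One pick *)

Section TrigBounds.
Context {R : realType}.
Implicit Types z A : R.

Lemma sin_mean_value z : exists2 c : R, `|c| <= `|z| & sin z = z * cos c.
Proof.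
have ds (x : R) : is_derive x (1 : R) (@sin R) (cos x) by exact: is_derive_sin.
have cs : continuous (@sin R) by exact: continuous_sin.
wlog z0 : z / 0 <= z => [H|].
  have [/H//|/ltW z0] := lerP 0 z.
  have [|c hc E] := H (- z); first by rewrite oppr_ge0.
  by exists c; [rewrite -(normrN z)|move: E; rewrite sinN mulNr => /oppr_inj].
have [|c] := @MVT_segment R sin cos 0 z z0 (fun x _ => ds x).
  exact: continuous_subspaceT.
rewrite in_itv/= => /andP[c0 cz]; rewrite sin0 !subr0 mulrC => E.
by exists c => //; rewrite !ger0_norm.
Qed.

Lemma ler_norm_sin z : `|sin z| <= `|z|.
Proof.
have [c _ ->] := sin_mean_value z.
by rewrite normrM ler_piMr// ler_norml cos_geN1 cos_le1.
Qed.

Lemma cos_half z : 1 - cos z = 2 * sin (z / 2) ^+ 2.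
Proof.
have {1}-> : z = z / 2 + z / 2 by field.
rewrite cosD; have := cos2Dsin2 (z / 2); nra.
Qed.

Lemma cos_sub1_le z : `|cos z - 1| <= `|z|.
Proof.
rewrite distrC cos_half.
have h := ler_norm_sin (z / 2).
have h2 : `|sin (z / 2)| <= 1 by rewrite ler_norml sin_geN1 sin_le1.
rewrite normrM normrX (ger0_norm (ler0n _ 2)).
move: h; rewrite normrM (ger0_norm (_ : 0 <= 2^-1))//.
have := normr_ge0 (sin (z / 2)); nra.
Qed.

Lemma cos_sub1_le2 z : `|cos z - 1| <= z ^+ 2.
Proof.
rewrite distrC cos_half.
have h := ler_norm_sin (z / 2).
rewrite normrM normrX (ger0_norm (ler0n _ 2)).
move: h; rewrite normrM (ger0_norm (_ : 0 <= 2^-1))//.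
rewrite -(real_normK (num_real z)).
have := normr_ge0 (sin (z / 2)); have := normr_ge0 z; nra.
Qed.

Lemma sin_sub_le2 z : `|sin z - z| <= z ^+ 2.
Proof.
have [c hc ->] := sin_mean_value z.
have -> : z * cos c - z = z * (cos c - 1) by ring.
rewrite normrM -(real_normK (num_real z)) expr2 ler_wpM2l//.
exact: le_trans (cos_sub1_le c) hc.
Qed.

Lemma sin_sub_le3 z : `|sin z - z| <= `|z| ^+ 3.
Proof.
have [c hc ->] := sin_mean_value z.
have -> : z * cos c - z = z * (cos c - 1) by ring.
rewrite normrM exprS ler_wpM2l//.
apply: le_trans (cos_sub1_le2 c) _.
by rewrite -(real_normK (num_real c)) lerXn2r// nnegrE.
Qed.

Lemma cos_taylor2_le z : `|cos z - 1 + z ^+ 2 / 2| <= `|z| ^+ 3.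
Proof.
have [c hc E] := sin_mean_value (z / 2).
have -> : cos z - 1 + z ^+ 2 / 2 = z ^+ 2 / 2 * sin c ^+ 2.
  have := cos_half z; rewrite E; have := cos2Dsin2 c.
  move=> h1 h2; have -> : sin c ^+ 2 = 1 - cos c ^+ 2 by rewrite -h1; ring.
  have -> : cos z = 1 - 2 * (z / 2 * cos c) ^+ 2 by rewrite -h2; ring.
  by field.
have h1 := le_trans (ler_norm_sin c) hc.
have h2 : `|sin c| <= 1 by rewrite ler_norml sin_geN1 sin_le1.
rewrite normrM normrX normrM normrX !(ger0_norm (_ : 0 <= 2^-1))//.
move: h1; rewrite normrM (ger0_norm (_ : 0 <= 2^-1))//.
set u := `|z|; set v := `|sin c| => h1.
have u0 : 0 <= u by exact: normr_ge0.
have v0 : 0 <= v by exact: normr_ge0.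
have v1 : v <= 1 by exact: h2.
have vu : v ^+ 2 <= u by nra.
have -> : u ^+ 3 = u ^+ 2 * u by rewrite exprSr.
rewrite -mulrA; apply: ler_wpM2l; first exact: sqr_ge0.
nra.
Qed.

Lemma cosD_taylor2 A z :
  `|cos (A + z) - (cos A - z * sin A - z ^+ 2 / 2 * cos A)| <= 2 * `|z| ^+ 3.
Proof.
have -> : cos (A + z) - (cos A - z * sin A - z ^+ 2 / 2 * cos A) =
  cos A * (cos z - 1 + z ^+ 2 / 2) - sin A * (sin z - z) by rewrite cosD; field.
have c1 : `|cos A| <= 1 by rewrite ler_norml cos_geN1 cos_le1.
have s1 : `|sin A| <= 1 by rewrite ler_norml sin_geN1 sin_le1.
rewrite (le_trans (ler_normB _ _))// !normrM mulr_natl mulr2n.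
apply: lerD.
  by rewrite (le_trans (ler_piMl _ c1))// cos_taylor2_le.
by rewrite (le_trans (ler_piMl _ s1))// sin_sub_le3.
Qed.

Lemma cosD_taylor1 A z : `|cos (A + z) - (cos A - z * sin A)| <= 2 * z ^+ 2.
Proof.
have -> : cos (A + z) - (cos A - z * sin A) =
  cos A * (cos z - 1) - sin A * (sin z - z) by rewrite cosD; ring.
have c1 : `|cos A| <= 1 by rewrite ler_norml cos_geN1 cos_le1.
have s1 : `|sin A| <= 1 by rewrite ler_norml sin_geN1 sin_le1.
rewrite (le_trans (ler_normB _ _))// !normrM mulr_natl mulr2n.
apply: lerD.
  by rewrite (le_trans (ler_piMl _ c1))// cos_sub1_le2.
by rewrite (le_trans (ler_piMl _ s1))// sin_sub_le2.
Qed.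

Lemma cosD_sub_le A z : `|cos (A + z) - cos A| <= 2 * `|z|.
Proof.
have -> : cos (A + z) - cos A =
  cos A * (cos z - 1) - sin A * sin z by rewrite cosD; ring.
have c1 : `|cos A| <= 1 by rewrite ler_norml cos_geN1 cos_le1.
have s1 : `|sin A| <= 1 by rewrite ler_norml sin_geN1 sin_le1.
rewrite (le_trans (ler_normB _ _))// !normrM mulr_natl mulr2n.
apply: lerD.
  by rewrite (le_trans (ler_piMl _ c1))// cos_sub1_le.
by rewrite (le_trans (ler_piMl _ s1))// ler_norm_sin.
Qed.

(** For the upper side, multiply by [1 + x]: [expR (- x) * (1 + x) <= 1], while
    [(1 - x + x ^+ 2) * (1 + x) = 1 + x ^+ 3]. *)
Lemma expRN_taylor1 (x : R) : 0 <= x -> `|expR (- x) - (1 - x)| <= x ^+ 2.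
Proof.
move=> x0; have h1 := expR_ge1Dx (- x); have h2 := expR_ge1Dx x.
have h3 : expR (- x) * expR x = 1 by rewrite -expRD addNr expR0.
have h4 := expR_gt0 (- x).
rewrite ger0_norm; last by lra.
have h5 : expR (- x) * (1 + x) <= 1 by rewrite -[leRHS]h3; apply: ler_wpM2l;
  [exact: expR_ge0 | exact: h2].
have h6 : (1 - x + x ^+ 2) * (1 + x) = 1 + x ^+ 3 by ring.
have h7 : 0 <= x ^+ 3 by exact: exprn_ge0.
have : expR (- x) * (1 + x) <= (1 - x + x ^+ 2) * (1 + x) by lra.
rewrite ler_pM2r; lra.
Qed.

Lemma expRN_dist_le (x y : R) : 0 <= x -> 0 <= y -> `|expR (- x) - expR (- y)| <= `|x - y|.
Proof.
wlog xy : x y / x <= y => [H x0 y0|x0 y0].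
  case/orP: (le_total x y) => xy; first exact: H.
  by rewrite distrC [leRHS]distrC; exact: H.
have h1 : expR (- y) = expR (- x) * expR (- (y - x)) by rewrite -expRD; congr expR; ring.
have h2 := expR_ge1Dx (- (y - x)).
have h3 : expR (- x) <= 1 by rewrite -expR0 ler_expR oppr_le0.
have h4 := expR_gt0 (- x).
have h5 : expR (- (y - x)) <= 1 by rewrite -expR0 ler_expR; lra.
rewrite ger0_norm; last by rewrite subr_ge0 ler_expR lerN2.
have -> : `|x - y| = y - x by rewrite distrC ger0_norm// subr_ge0.
rewrite h1; nra.
Qed.
End TrigBounds.

(** * The effect of one pick on a cosine of the centred counts *)

Section PickCos.
Context {R : realType}.

Lemma ler_norm_lin2 (a b u v U V : R) : `|u| <= U -> `|v| <= V ->
  `|a * u + b * v| <= `|a| * U + `|b| * V.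
Proof.
move=> hu hv; rewrite (le_trans (ler_normD _ _))// !normrM.
by apply: lerD; apply: ler_wpM2l.
Qed.

Lemma ler_norm_alternating6 (b0 b1 b2 b3 b4 b5 B0 B1 B2 B3 B4 B5 : R) :
  `|b0| <= B0 -> `|b1| <= B1 -> `|b2| <= B2 -> `|b3| <= B3 -> `|b4| <= B4 -> `|b5| <= B5 ->
  `|b0 - b1 + b2 - b3 + b4 - b5| <= B0 + B1 + B2 + B3 + B4 + B5.
Proof.
move=> h0 h1 h2 h3 h4 h5; do 5![apply: le_trans (ler_normD _ _) _; apply: lerD;
  rewrite ?normrN//].
Qed.

(** The three points are the outcomes of a pick: a node of outdegree 0, of outdegree 1, or higher.
    The bound [2 * e] anticipates that [U - X] can jump by 2, and [16] is [2 * 2 ^ 3]. *)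
Lemma three_point_cos (p0 p1 A z0 z1 z2 : R) (e : R) :
  0 <= p0 -> 0 <= p1 -> p0 + p1 <= 1 ->
  `|z0| <= 2 * e -> `|z1| <= 2 * e -> `|z2| <= 2 * e ->
  `|p0 * cos (A + z0) + p1 * cos (A + z1) + (1 - p0 - p1) * cos (A + z2)
    - (cos A - (p0 * z0 + p1 * z1 + (1 - p0 - p1) * z2) * sin A
       - (p0 * z0 ^+ 2 + p1 * z1 ^+ 2 + (1 - p0 - p1) * z2 ^+ 2) / 2 * cos A)| <=
           16 * e ^+ 3.
Proof.
move=> h0 h1 h01 hz0 hz1 hz2; set p2 := 1 - p0 - p1.
have h2 : 0 <= p2 by rewrite /p2; lra.
have T z : `|z| <= 2 * e -> `|cos (A + z) - (cos A - z * sin A - z ^+ 2 / 2 * cos A)| <=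
  16 * e ^+ 3.
  move=> hz; apply: (le_trans (cosD_taylor2 _ _)).
  have -> : 16 * e ^+ 3 = 2 * (2 * e) ^+ 3 by ring.
  by apply: ler_wpM2l => //; rewrite lerXn2r// nnegrE// (le_trans _ hz).
set c0 := _ - _; set B := 16 * e ^+ 3 in T *.
have -> : c0 = p0 * (cos (A + z0) - (cos A - z0 * sin A - z0 ^+ 2 / 2 * cos A))
   + p1 * (cos (A + z1) - (cos A - z1 * sin A - z1 ^+ 2 / 2 * cos A))
   + p2 * (cos (A + z2) - (cos A - z2 * sin A - z2 ^+ 2 / 2 * cos A)).
  by rewrite /c0 /p2; field.
have -> : B = p0 * B + p1 * B + p2 * B by rewrite /p2; ring.
rewrite (le_trans (ler_normD _ _))//; apply: lerD.
  rewrite (le_trans (ler_normD _ _))//; apply: lerD;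
    rewrite normrM ger0_norm// ler_wpM2l//; exact: T.
by rewrite normrM ger0_norm// ler_wpM2l//; exact: T.
Qed.

(* [x] and [y] are the centred counts, and [(q0, q1, t)] the limits of [p0], [p1]
   and of the drift [2 p0 - p1] of the second coordinate. *)
Lemma pick_cos (K K1 q0 q1 t : R) : 0 <= K -> 0 <= K1 ->
  0 <= q0 -> 0 <= q1 -> q0 + q1 <= 1 -> t = 2 * q0 - q1 -> 0 <= t <= 1 ->
  exists2 C, 0 <= C & forall al be th x y w p0 p1 k0 k1 : R,
  let e := `|al| + `|be| in
  let z0 := al * (q0 - 1) + be * (t - 2) in
  let z1 := al * q0 + be * (t + 1) in
  let z2 := al * q0 + be * t in
  let q := q0 * z0 ^+ 2 + q1 * z1 ^+ 2 + (1 - q0 - q1) * z2 ^+ 2 in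
  let A := al * x + be * y + th in
  e <= K -> 1 <= w -> 0 <= p0 -> 0 <= p1 -> p0 + p1 <= 1 ->
  p0 = q0 + (x + k0) / w -> p1 = 2 * p0 - t - 2 * (y + k1) / w ->
  `|k0| <= K1 -> `|k1| <= K1 ->
  `|p0 * cos (A + z0) + p1 * cos (A + z1) + (1 - p0 - p1) * cos (A + z2)
   - expR (- (q / 2)) * cos (al * (1 - w^-1) * x + be * (1 - 2 / w) * y + th)|
  <= C * e * (e ^+ 2 + w^-1 + (x ^+ 2 + y ^+ 2) / w ^+ 2).
Proof.
move=> K0 K10 hq0 hq1 hq01 tE /andP[t0 t1].
(* [C] adds up the six errors below: 16 and 10 from the cubic remainder and from the change of
   variance, [20 * K] as [8 + 8 + 4], and the [K1] terms from the corrections [k0], [k1]. The outer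
   factor 2 pays for replacing [r ^+ 2] by the sum of squares. *)
pose C := 26 + 20 * K + 2 * K1 + 10 * (K * K1).
have KK1 : 0 <= K * K1 by exact: mulr_ge0.
exists (2 * C); first by rewrite /C; lra.
move=> al be th x y w p0 p1 k0 k1 e z0 z1 z2 q A eK w1 hp0 hp1 hp01 p0E p1E hk0 hk1.
have w0 : 0 < w by lra.
have wi0 : 0 < w^-1 by rewrite invr_gt0.
have e0 : 0 <= e by rewrite addr_ge0.
pose r := (`|x| + `|y|) / w.
have r0 : 0 <= r by rewrite divr_ge0 ?addr_ge0// ltW.
pose T := e ^+ 2 + w^-1 + r ^+ 2.
have e20 := sqr_ge0 e; have r20 := sqr_ge0 r.
have T0 : 0 <= T by rewrite /T; clear -wi0 e20 r20; lra.
have TT : T <= 2 * (e ^+ 2 + w^-1 + (x ^+ 2 + y ^+ 2) / w ^+ 2).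
  have : r ^+ 2 <= 2 * ((x ^+ 2 + y ^+ 2) / w ^+ 2).
    rewrite /r expr_div_n mulrA ler_wpM2r ?invr_ge0 ?sqr_ge0//.
    rewrite -(real_normK (num_real x)) -(real_normK (num_real y)).
    have := sqr_ge0 (`|x| - `|y|); nra.
  by rewrite /T; clear -e20 wi0; lra.
suff main : `|p0 * cos (A + z0) + p1 * cos (A + z1) + (1 - p0 - p1) * cos (A + z2)
   - expR (- (q / 2)) * cos (al * (1 - w^-1) * x + be * (1 - 2 / w) * y + th)| <=
       C * (e * T).
  apply: (le_trans main).
  set X := e ^+ 2 + w^-1 + _ in TT *.
  have -> : 2 * C * e * X = C * (e * (2 * X)) by ring.
  by apply: ler_wpM2l; [rewrite /C; lra | apply: ler_wpM2l].
have al_e : `|al| <= e by rewrite lerDl.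
have be_e : `|be| <= e by rewrite lerDr.
have az0 : `|z0| <= 2 * e.
  apply: le_trans (ler_norm_lin2 _ _ _ _ 1 2 _ _) _.
  - by rewrite ler_norml; clear -hq0 hq1 hq01 t0 t1; lra.
  - by rewrite ler_norml; clear -hq0 hq1 hq01 t0 t1; lra.
  - by rewrite /e; have := normr_ge0 al; clear; lra.
have az1 : `|z1| <= 2 * e.
  apply: le_trans (ler_norm_lin2 _ _ _ _ 1 2 _ _) _.
  - by rewrite ler_norml; clear -hq0 hq1 hq01 t0 t1; lra.
  - by rewrite ler_norml; clear -hq0 hq1 hq01 t0 t1; lra.
  - by rewrite /e; have := normr_ge0 al; clear; lra.
have az2 : `|z2| <= 2 * e.
  apply: le_trans (ler_norm_lin2 _ _ _ _ 1 2 _ _) _.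
  - by rewrite ler_norml; clear -hq0 hq1 hq01 t0 t1; lra.
  - by rewrite ler_norml; clear -hq0 hq1 hq01 t0 t1; lra.
  - by rewrite /e; have := normr_ge0 al; clear; lra.
have sz (z : R) : `|z| <= 2 * e -> 0 <= z ^+ 2 <= 4 * e ^+ 2.
  move=> hz; rewrite sqr_ge0 /= -(real_normK (num_real z)).
  have -> : 4 * e ^+ 2 = (2 * e) ^+ 2 by ring.
  by rewrite lerXn2r// nnegrE// (le_trans _ hz).
have P1 := three_point_cos p0 p1 A z0 z1 z2 e hp0 hp1 hp01 az0 az1 az2.
set m1 := (_ * z0 + _ * z1 + _) in P1; set m2 := (_ * z0 ^+ 2 + _ * z1 ^+ 2 + _) in P1.
(* The mean phase jump splits into [v], exactly the phase change produced by the contracted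
   frequencies, and the error [d] due to [k0] and [k1]. *)
pose v := - (al * x + be * (2 * y)) / w.
pose d := (al * k0 + be * (2 * k1)) / w.
have m1E : m1 = v - d.
  have -> : m1 = al * (q0 - p0) + be * (p1 - 2 * p0 + t) by rewrite /m1 /z0 /z1 /z2; ring.
  rewrite p1E p0E /v /d; field; by rewrite gt_eqF.
have av : `|v| <= 2 * (e * r).
  have -> : 2 * (e * r) = 2 * (e * (`|x| + `|y|)) / w by rewrite /r; ring.
  rewrite /v normrM normrN (ger0_norm (ltW wi0)) ler_wpM2r ?(ltW wi0)//.
  apply: le_trans (ler_norm_lin2 _ _ _ _ `|x| (2 * `|y|) _ _) _ => //.
    by rewrite normrM ger0_norm.
  have := normr_ge0 x; have := normr_ge0 y; have := normr_ge0 al; have := normr_ge0 be.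
  rewrite /e; clear; nra.
have ad : `|d| <= 2 * (e * (K1 * w^-1)).
  have -> : 2 * (e * (K1 * w^-1)) = 2 * (e * K1) / w by ring.
  rewrite /d normrM (ger0_norm (ltW wi0)) ler_wpM2r ?(ltW wi0)//.
  apply: le_trans (ler_norm_lin2 _ _ _ _ K1 (2 * K1) _ _) _ => //.
    by rewrite normrM ger0_norm// ler_wpM2l.
  have := normr_ge0 al; rewrite /e; clear -K10; nra.
have ap0 : `|p0 - q0| <= r + K1 * w^-1.
  rewrite p0E addrAC subrr add0r normrM (ger0_norm (ltW wi0)) /r -mulrDl ler_wpM2r
    ?(ltW wi0)//.
  by rewrite (le_trans (ler_normD _ _))// lerD// lerDl.
have ayk : `|(y + k1) / w| <= r + K1 * w^-1.
  rewrite normrM (ger0_norm (ltW wi0)) /r -mulrDl ler_wpM2r ?(ltW wi0)//.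
  by rewrite (le_trans (ler_normD _ _))// lerD// lerDr.
have ap1 : `|p1 - q1| <= 4 * (r + K1 * w^-1).
  have -> : p1 - q1 = 2 * (p0 - q0) - 2 * ((y + k1) / w) by rewrite p1E tE; ring.
  rewrite (le_trans (ler_normB _ _))// !normrM (ger0_norm (ler0n _ 2)).
  move: ayk ap0; rewrite normrM; clear; lra.
have K1w : 0 <= K1 * w^-1 by rewrite mulr_ge0// ltW.
have am2 : `|m2 - q| <= 20 * (e ^+ 2 * (r + K1 * w^-1)).
  have -> : m2 - q = (z0 ^+ 2 - z2 ^+ 2) * (p0 - q0) + (z1 ^+ 2 - z2 ^+ 2) * (p1 - q1).
    by rewrite /m2 /q; ring.
  have /andP[a0 b0] := sz _ az0; have /andP[a1 b1] := sz _ az1;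
    have /andP[a2 b2] := sz _ az2.
  apply: le_trans (ler_norm_lin2 _ _ _ _ _ _ ap0 ap1) _.
  have h0 : `|z0 ^+ 2 - z2 ^+ 2| <= 4 * e ^+ 2 by rewrite ler_norml; clear -a0 b0 a2 b2;
    lra.
  have h1 : `|z1 ^+ 2 - z2 ^+ 2| <= 4 * e ^+ 2 by rewrite ler_norml; clear -a1 b1 a2 b2;
    lra.
  have rK : 0 <= r + K1 * w^-1 by exact: addr_ge0.
  have := ler_wpM2r rK h0; have := ler_wpM2r rK h1; clear; lra.
have q_ge0 : 0 <= q.
  by rewrite /q; apply: addr_ge0; [apply: addr_ge0|]; apply: mulr_ge0 (sqr_ge0 _) => //;
    clear -hq01; lra.
have q_le : q <= 4 * e ^+ 2.
  have /andP[a0 b0] := sz _ az0; have /andP[a1 b1] := sz _ az1;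
    have /andP[a2 b2] := sz _ az2.
  have h2 : 0 <= 1 - q0 - q1 by clear -hq01; lra.
  have := ler_wpM2l hq0 b0; have := ler_wpM2l hq1 b1; have := ler_wpM2l h2 b2.
  rewrite /q; clear; lra.
have -> : al * (1 - w^-1) * x + be * (1 - 2 / w) * y + th = A + v.
  by rewrite /A /v; field; rewrite gt_eqF.
set S := p0 * cos (A + z0) + p1 * cos (A + z1) + (1 - p0 - p1) * cos (A + z2) in P1 *.
have cA (B : R) : `|cos B| <= 1 by rewrite ler_norml cos_geN1 cos_le1.
have sA (B : R) : `|sin B| <= 1 by rewrite ler_norml sin_geN1 sin_le1.
have q20 : 0 <= q / 2 by exact: divr_ge0.
have B1 := cosD_taylor1 A v.
have B2 : `|d * sin A| <= 2 * (e * (K1 * w^-1)).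
  by rewrite normrM (le_trans _ ad)// ler_piMr.
have B3 : `|(m2 - q) / 2 * cos A| <= 10 * (e ^+ 2 * (r + K1 * w^-1)).
  rewrite normrM normrM (ger0_norm (_ : 0 <= 2^-1))//.
  apply: le_trans (ler_piMr _ (cA A)) _; first by rewrite mulr_ge0.
  clear -am2; lra.
have B4 : `|q / 2 * (cos (A + v) - cos A)| <= 8 * (e ^+ 2 * (e * r)).
  rewrite normrM (ger0_norm q20).
  apply: le_trans (ler_wpM2l q20 (cosD_sub_le _ _)) _.
  have er : 0 <= e * r by exact: mulr_ge0.
  have := ler_wpM2l q_ge0 av; have := ler_wpM2r er q_le; clear; lra.
have B5 : `|(expR (- (q / 2)) - (1 - q / 2)) * cos (A + v)| <= 4 * (e ^+ 2 * e ^+ 2).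
  rewrite normrM; apply: le_trans (ler_piMr _ (cA _)) _ => //.
  apply: le_trans (expRN_taylor1 _ q20) _.
  have := ler_wpM2l q_ge0 q_le; have := ler_wpM2r e20 q_le.
  rewrite expr2; clear; lra.
set b1 := cos (A + v) - _ in B1.
set b2 := d * _ in B2. set b3 := _ * cos A in B3. set b4 := q / 2 * _ in B4.
set b5 := _ * cos (A + v) in B5.
set b0 := S - _ in P1.
(* In order: the Taylor remainder of the jumps, that of the shift [v], the correction [d], the
   variance at actual instead of limiting probabilities, the cross term between variance and shift,
   and the linearization of the exponential. *)
have -> : S - expR (- (q / 2)) * cos (A + v) = b0 - b1 + b2 - b3 + b4 - b5.
  by rewrite /b0 /b1 /b2 /b3 /b4 /b5 m1E; field.
have v2 : v ^+ 2 <= 4 * (e * r) ^+ 2.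
  rewrite -(real_normK (num_real v)).
  have -> : 4 * (e * r) ^+ 2 = (2 * (e * r)) ^+ 2 by ring.
  by rewrite lerXn2r// nnegrE// (le_trans _ av).
(* From here on every error is brought to the form [e * T]; surplus factors [e] are spent through
   [e <= K]. *)
have erT : e * r <= T by have := sqr_ge0 (e - r); rewrite /T; clear -wi0 e20 r20; nra.
have eT0 : 0 <= e * T by exact: mulr_ge0.
have r2T : r ^+ 2 <= T by rewrite /T; clear -wi0 e20 r20; lra.
have e2T : e ^+ 2 <= T by rewrite /T; clear -wi0 e20 r20; lra.
have wT : w^-1 <= T by rewrite /T; clear -wi0 e20 r20; lra.
have KeT := ler_wpM2r eT0 eK.
have F0 : e ^+ 3 <= e * T by rewrite exprS ler_wpM2l.
have F1 : (e * r) ^+ 2 <= K * (e * T).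
  have -> : (e * r) ^+ 2 = e * (e * r ^+ 2) by ring.
  by apply: le_trans KeT; apply: ler_wpM2l => //; apply: ler_wpM2l.
have F2 : e * (K1 * w^-1) <= K1 * (e * T).
  rewrite mulrCA; apply: ler_wpM2l => //; exact: ler_wpM2l.
have F3 : e ^+ 2 * (r + K1 * w^-1) <= e * T + K * K1 * (e * T).
  have -> : e ^+ 2 * (r + K1 * w^-1) = e * (e * r) + e * (e * (K1 * w^-1)) by ring.
  apply: lerD; first exact: ler_wpM2l.
  have F2' : 0 <= e * (K1 * w^-1) by exact: mulr_ge0.
  apply: le_trans (ler_wpM2r F2' eK) _.
  by rewrite -mulrA; apply: ler_wpM2l.
have F4 : e ^+ 2 * (e * r) <= K * (e * T).
  have -> : e ^+ 2 * (e * r) = e * (e * (e * r)) by ring.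
  by apply: le_trans KeT; apply: ler_wpM2l => //; apply: ler_wpM2l.
have F5 : e ^+ 2 * e ^+ 2 <= K * (e * T).
  have -> : e ^+ 2 * e ^+ 2 = e * (e * e ^+ 2) by ring.
  by apply: le_trans KeT; apply: ler_wpM2l => //; apply: ler_wpM2l.
have CE : C * (e * T) = 26 * (e * T) + 20 * (K * (e * T)) + 2 * (K1 * (e * T)) +
  10 * (K * K1 * (e * T)).
  by rewrite /C; ring.
rewrite CE.
apply: le_trans (ler_norm_alternating6 _ _ _ _ _ _ _ _ _ _ _ _ P1 B1 B2 B3 B4 B5) _.
clear -F0 F1 F2 F3 F4 F5 v2.
lra.
Qed.
End PickCos.

(** * The chain of outdegree sequences *)

Section Chain.
Context {R : realType}.
Implicit Types (s : seq (seq nat * R)) (g h : seq nat -> R) (d : seq nat).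

Definition expect s g : R := \sum_(x <- s) x.2 * g x.1.

Definition pick_mean g d : R :=
  \sum_(i <- iota 0 (size d))
    (nth 0%N d i).+1%:R / (sumn (map succn d))%:R * g (incr_nth d i).

Lemma expect_pick_step s g : expect (pick_step s) g = expect s (pick_mean g).
Proof.
rewrite /expect /pick_step big_flatten big_map; apply: eq_bigr => -[d p] _ /=.
rewrite big_map /pick_mean mulr_sumr; apply: eq_bigr => i _ /=.
by rewrite !mulrA.
Qed.

Lemma expect_node_step m s g :
  expect (node_step m s) g = expect (iter m (@pick_step R) s) (fun d => g (rcons d 0%N)).
Proof. by rewrite /expect /node_step big_map. Qed.

Lemma sumn_map_succn d : sumn (map succn d) = (sumn d + size d)%N.
Proof. by elim: d => //= a d ->; rewrite addSn addnS addnA. Qed.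

Lemma sumn_incr d i : sumn (incr_nth d i) = (sumn d).+1.
Proof.
elim: d i => [|a d IH] [|i] //=; last by rewrite IH addnS.
by rewrite sumn_ncons.
Qed.

Lemma count_incr (p : pred nat) d i : (i < size d)%N ->
  (count p (incr_nth d i) + p (nth 0%N d i) = count p d + p (nth 0%N d i).+1)%N.
Proof.
elim: d i => [|a d IH] [|i] //= hi; first lia.
by have := IH i hi; lia.
Qed.

Lemma sum_nth_iota (F : nat -> R) d :
  \sum_(i <- iota 0 (size d)) F (nth 0%N d i) = \sum_(a <- d) F a.
Proof. by rewrite [RHS](big_nth 0%N) /index_iota subn0. Qed.

Lemma sum_count (p : pred nat) d : \sum_(a <- d) (p a)%:R = (count p d)%:R :> R.
Proof.
elim: d => [|a d IH]; first by rewrite big_nil.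
by rewrite big_cons IH -natrD.
Qed.

Lemma sum_succn d : \sum_(a <- d) a.+1%:R = (sumn (map succn d))%:R :> R.
Proof.
elim: d => [|a d IH]; first by rewrite big_nil.
by rewrite big_cons IH -natrD.
Qed.

Lemma pick_meanE (h : R -> R -> R) d : (0 < size d)%N ->
  let w : R := (sumn (map succn d))%:R in
  let u : R := (Ydeg 0 d)%:R in
  let x : R := (Ydeg 1 d)%:R in
  let p0 := u / w in let p1 := 2 * x / w in
  pick_mean (fun d => h (Ydeg 0 d)%:R (Ydeg 1 d)%:R) d =
  p0 * h (u - 1) (x + 1) + p1 * h u (x - 1) + (1 - p0 - p1) * h u x.
Proof.
move=> d0 w u x p0 p1.
have w0 : w != 0 by rewrite /w pnatr_eq0 sumn_map_succn; lia.
(* [G] gives every node the unchanged value [h u x] and corrects it only for outdegrees 0 and 1,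
   whose weights are 1 and 2. The sum then needs just the total weight and two counts. *)
pose G (a : nat) := a.+1%:R / w * h u x + (a == 0)%:R / w * (h (u - 1) (x + 1) - h u x)
   + (a == 1)%:R * (2 / w) * (h u (x - 1) - h u x).
transitivity (\sum_(i <- iota 0 (size d)) G (nth 0%N d i)).
  rewrite /pick_mean -/w; apply: eq_big_seq => i; rewrite mem_iota add0n => /andP[_ hi].
  have /(congr1 (fun n => n%:R : R)) := count_incr (pred1 0%N) d i hi.
  have /(congr1 (fun n => n%:R : R)) := count_incr (pred1 1%N) d i hi.
  rewrite !natrD -/(Ydeg 0 d) -/(Ydeg 1 d) -/u -/x -/(Ydeg 0 (incr_nth d i))
    -/(Ydeg 1 (incr_nth d i)).
  rewrite /G; set a := nth _ _ _; case: a => [|[|a]] /= h1 h2.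
  - have -> : (Ydeg 0 (incr_nth d i))%:R = u - 1 :> R by lra.
    have -> : (Ydeg 1 (incr_nth d i))%:R = x + 1 :> R by lra.
    by field.
  - have -> : (Ydeg 0 (incr_nth d i))%:R = u :> R by lra.
    have -> : (Ydeg 1 (incr_nth d i))%:R = x - 1 :> R by lra.
    by field.
  - have -> : (Ydeg 0 (incr_nth d i))%:R = u :> R by lra.
    have -> : (Ydeg 1 (incr_nth d i))%:R = x :> R by lra.
    by rewrite /=; ring.
rewrite sum_nth_iota /G !big_split /= -!mulr_suml.
rewrite sum_succn (sum_count (pred1 0%N)) (sum_count (pred1 1%N)).
rewrite -/(Ydeg 0 d) -/(Ydeg 1 d) -/u -/x -/w /p0 /p1; field.
exact: w0.
Qed.

Lemma Ydeg_weight d : (Ydeg 0 d + 2 * Ydeg 1 d <= sumn (map succn d))%N.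
Proof. by rewrite /Ydeg; elim: d => //= -[|[|a]] d /=; lia. Qed.

Lemma Ydeg_rcons k d : Ydeg k (rcons d 0%N) = (Ydeg k d + (k == 0))%N.
Proof. by rewrite /Ydeg -cats1 count_cat /= addn0 eq_sym. Qed.

(** Size and number of edges are fixed on the whole support, which makes the total weight
    deterministic. The same state may occur several times in the list. *)
Definition is_law (k t : nat) s := \sum_(x <- s) x.2 = 1 /\
  forall x, x \in s -> [/\ 0 <= x.2, size x.1 = k & sumn x.1 = t].

Lemma is_law_pick_step k t s : (0 < k)%N -> is_law k t s -> is_law k t.+1 (pick_step s).
Proof.
move=> k0 [s1 hs]; split.
  have := expect_pick_step s (fun=> 1).
  rewrite /expect; under eq_bigr do rewrite mulr1.
  move=> ->; rewrite -[RHS]s1; apply: eq_big_seq => x /hs [_ sx tx].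
  rewrite /pick_mean; under eq_bigr do rewrite mulr1.
  rewrite -mulr_suml (sum_nth_iota (fun a => a.+1%:R)) sum_succn divff ?mulr1//.
  by rewrite pnatr_eq0 sumn_map_succn sx; lia.
move=> x /flattenP[l /mapP[[d p] /hs[/= p0 sd td] ->]] /mapP[i].
rewrite mem_iota add0n => /andP[_ hi] -> /=; split.
- by rewrite divr_ge0// mulr_ge0.
- by rewrite size_incr_nth hi.
- by rewrite sumn_incr td.
Qed.

Lemma is_law_rcons k t s : is_law k t s ->
  is_law k.+1 t (map (fun x : seq nat * R => (rcons x.1 0%N, x.2)) s).
Proof.
move=> [s1 hs]; split; first by rewrite big_map.
move=> x /mapP[y /hs[y0 sy ty] ->] /=; rewrite size_rcons sy; split => //.
by rewrite sumn_rcons ty addn0.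
Qed.

Lemma is_law_picks k t s j : (0 < k)%N -> is_law k t s ->
  is_law k (t + j) (iter j (@pick_step R) s).
Proof.
move=> k0 ls; elim: j => [|j IH]; first by rewrite addn0.
by rewrite addnS; exact: is_law_pick_step.
Qed.

Lemma is_law_pac m n : is_law n.+1 (m * n) (pac_dist R m n).
Proof.
elim: n => [|n IH].
  rewrite muln0; split; first by rewrite big_seq1.
  by move=> x; rewrite inE => /eqP ->; split.
rewrite mulnS addnC; apply: is_law_rcons; exact: is_law_picks.
Qed.

Lemma expect_lin s k g h : expect s (fun d => k * g d + h d) = k * expect s g + expect s h.
Proof.
rewrite /expect mulr_sumr -big_split /=; apply: eq_bigr => x _; ring.
Qed.

Lemma expect_cst k t s (c : R) : is_law k t s -> expect s (fun=> c) = c.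
Proof. by move=> [s1 _]; rewrite /expect -mulr_suml s1 mul1r. Qed.

Lemma le_expect k t s g h : is_law k t s ->
  (forall d, size d = k -> sumn d = t -> g d <= h d) -> expect s g <= expect s h.
Proof.
move=> [_ hs] gh; rewrite /expect big_seq [leRHS]big_seq; apply: ler_sum => x /hs[x0 sx tx].
by apply: ler_wpM2l => //; exact: gh.
Qed.

Lemma eq_expect k t s g h : is_law k t s ->
  (forall d, size d = k -> sumn d = t -> g d = h d) -> expect s g = expect s h.
Proof.
move=> ls gh; apply/eqP; rewrite eq_le.
by apply/andP; split; apply: (le_expect k t) => // d h1 h2; rewrite gh.
Qed.

Lemma expect_dist k t s g h e : is_law k t s ->
  (forall d, size d = k -> sumn d = t -> `|g d - h d| <= e d) ->
  `|expect s g - expect s h| <= expect s e.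
Proof.
move=> ls ghe.
have up : expect s g <= expect s e + expect s h.
  rewrite -(mul1r (expect s e)) -expect_lin; apply: (le_expect k t) => // d h1 h2.
  by have := ghe d h1 h2; rewrite ler_norml; lra.
have lo : expect s h <= expect s e + expect s g.
  rewrite -(mul1r (expect s e)) -expect_lin; apply: (le_expect k t) => // d h1 h2.
  by have := ghe d h1 h2; rewrite ler_norml; lra.
by rewrite ler_norml; apply/andP; split; lra.
Qed.
End Chain.

(** * The limiting covariance and its Lyapunov equation *)

Section Covariance.
Context {R : realType}.
Implicit Types M al be : R.

Definition sig11 M : R := 2 * M ^+ 2 * (M + 1) / ((3 * M + 1) * (2 * M + 1) ^+ 2).
Definition sig12 M : R := - (4 * (M + 1) ^+ 2 * M ^+ 2
                   / ((4 * M + 1) * (3 * M + 1) * (2 * M + 1) ^+ 2)).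
Definition sig22 M : R := 2 * M ^+ 2 * (M + 1)
                 * (48 * M ^+ 3 + 59 * M ^+ 2 + 27 * M + 4)
                 / ((5 * M + 1) * (4 * M + 1) * (3 * M + 1) ^+ 2
                    * (2 * M + 1) ^+ 2).

(* The quadratic form of the limit law in the coordinates [(U, U - X)]. *)
Definition qform M al be : R :=
  sig11 M * (al + be) ^+ 2 - 2 * sig12 M * (al + be) * be + sig22 M * be ^+ 2.

(** The variance of [al], [be] applied to one centred jump under the limiting probabilities [q0] and
    [q1]; that jump has mean zero because [t = 2 q0 - q1]. *)
Definition pick_var M al be : R :=
  let q0 := (2 * M + 1)^-1 in let q1 := 2 * M / ((3 * M + 1) * (2 * M + 1)) in
  let t := 2 / (3 * M + 1) in
  let z0 := al * (q0 - 1) + be * (t - 2) in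
  let z1 := al * q0 + be * (t + 1) in
  let z2 := al * q0 + be * t in
  q0 * z0 ^+ 2 + q1 * z1 ^+ 2 + (1 - q0 - q1) * z2 ^+ 2.

(** The balance that determines the covariance: the variance injected by a pick equals the growth
    [qform / M] over a time [1 / M], plus the loss by contraction, namely the derivative of [qform]
    along [(al, 2 be)] divided by [M + 1], since [w] is about [(M + 1) n]. *)
Lemma lyapunov M al be : 0 < M ->
  pick_var M al be = qform M al be / M + 2 / (M + 1) *
   (sig11 M * al ^+ 2 + 3 * (sig11 M - sig12 M) * al * be +
     2 * (sig11 M - 2 * sig12 M + sig22 M) * be ^+ 2).
Proof.
move=> M0; rewrite /pick_var /qform /sig11 /sig12 /sig22; field.
by do ?[apply/andP; split]; rewrite gt_eqF//; lra.
Qed.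

Lemma sig11_gt0 M : 0 < M -> 0 < sig11 M.
Proof.
move=> M0; rewrite /sig11; apply: divr_gt0; apply: mulr_gt0; rewrite ?exprn_gt0//; try lra.
by apply: mulr_gt0; rewrite ?exprn_gt0.
Qed.

Lemma sig_det_gt0 M : 0 < M -> 0 < sig11 M * sig22 M - sig12 M ^+ 2.
Proof.
move=> M0.
have -> : sig11 M * sig22 M - sig12 M ^+ 2 =
  4 * M ^+ 4 * (M + 1) ^+ 2 * (132 * M ^+ 4 + 132 * M ^+ 3 + 39 * M ^+ 2 + 3 * M) /
  ((5 * M + 1) * (4 * M + 1) ^+ 2 * (3 * M + 1) ^+ 3 * (2 * M + 1) ^+ 4).
  rewrite /sig11 /sig12 /sig22; field.
  by do ?[apply/andP; split]; rewrite gt_eqF//; lra.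
have P n : 0 < M ^+ n by exact: exprn_gt0.
have P2 := P 2%N; have P3 := P 3%N; have P4 := P 4%N.
apply: divr_gt0; last by do 3?apply: mulr_gt0; rewrite ?exprn_gt0//; lra.
by do 2?apply: mulr_gt0; rewrite ?mulr_gt0 ?exprn_gt0//; lra.
Qed.

Lemma qform_ge0 M al be : 0 < M -> 0 <= qform M al be.
Proof.
move=> M0; have a0 := sig11_gt0 M M0; have D0 := sig_det_gt0 M M0.
have : sig11 M * qform M al be = (sig11 M * (al + be) - sig12 M * be) ^+ 2 +
   (sig11 M * sig22 M - sig12 M ^+ 2) * be ^+ 2 by rewrite /qform; ring.
move=> E; rewrite -(pmulr_rge0 _ a0) E addr_ge0 ?sqr_ge0// mulr_ge0 ?sqr_ge0// ltW//.
Qed.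

Lemma qform_step M : 0 < M -> exists2 C, 0 <= C & forall (n j al be w : R),
  0 <= n -> 0 <= j <= M -> w = (M + 1) * n + 1 + j ->
  `|(n + (j + 1) / M) * qform M al be - pick_var M al be
    - (n + j / M) * qform M (al * (1 - w^-1)) (be * (1 - 2 / w))| <=
        C * (`|al| + `|be|) ^+ 2 / w.
Proof.
move=> M0.
pose S11 := sig11 M; pose S12 := sig11 M - sig12 M;
  pose S22 := sig11 M - 2 * sig12 M + sig22 M.
exists (3 * (`|S11| + 6 * `|S12| + 4 * `|S22|)).
  have := normr_ge0 S11; have := normr_ge0 S12; have := normr_ge0 S22; lra.
move=> n j al be w n0 /andP[j0 jM] wE.
have w0 : 0 < w by rewrite wE; nra.
have nw : 0 <= (n + j / M) / w <= 1.
  have jM1 : 0 <= j / M <= 1 by rewrite divr_ge0 ?(ltW M0)//= ler_pdivrMr// mul1r.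
  rewrite divr_ge0 ?addr_ge0 ?(ltW w0)//=; [|lra].
  by rewrite ler_pdivrMr// mul1r wE; nra.
have QE a b : qform M a b = S11 * a ^+ 2 + 2 * S12 * a * b + S22 * b ^+ 2.
  by rewrite /qform /S11 /S12 /S22; ring.
pose L := S11 * al ^+ 2 + 3 * S12 * al * be + 2 * S22 * be ^+ 2.
pose T := S11 * al ^+ 2 + 4 * S12 * al * be + 4 * S22 * be ^+ 2.
(* Two terms survive the Lyapunov equation: the mismatch [(M + 1) (n + j / M) - w = j / M - 1] in
   the first-order part, and the second-order part [T], which is the form at [(al, 2 be)]. *)
have -> : (n + (j + 1) / M) * qform M al be - pick_var M al be
    - (n + j / M) * qform M (al * (1 - w^-1)) (be * (1 - 2 / w)) =
   (2 * L * ((j / M - 1) / (M + 1)) - ((n + j / M) / w) * T) / w.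
  rewrite lyapunov// -/S11 -/S12 -/S22 -/L !QE /T /L wE; field.
  by do ?[apply/andP; split]; rewrite gt_eqF//; move: w0; rewrite wE; lra.
rewrite normrM (ger0_norm (_ : 0 <= w^-1)) ?invr_ge0 ?(ltW w0)// ler_wpM2r ?invr_ge0
  ?(ltW w0)//.
set e := `|al| + `|be|.
have aa : al ^+ 2 <= e ^+ 2.
  by rewrite -(real_normK (num_real al)) lerXn2r ?nnegrE ?addr_ge0// lerDl.
have bb : be ^+ 2 <= e ^+ 2.
  by rewrite -(real_normK (num_real be)) lerXn2r ?nnegrE ?addr_ge0// lerDr.
have ab : `|al * be| <= e ^+ 2.
  by rewrite normrM expr2; apply: ler_pM; rewrite // ?lerDl ?lerDr.
have aa0 := sqr_ge0 al; have bb0 := sqr_ge0 be.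
have bnd k1 k2 : 0 <= k1 -> 0 <= k2 -> `|S11 * al ^+ 2 + k1 * S12 * al * be +
  k2 * S22 * be ^+ 2| <=
   (`|S11| + k1 * `|S12| + k2 * `|S22|) * e ^+ 2.
  move=> h1 h2; rewrite !mulrDl.
  apply: le_trans (ler_normD _ _) _; apply: lerD;
    [apply: le_trans (ler_normD _ _) _; apply: lerD|].
  - by rewrite normrM (ger0_norm aa0) ler_wpM2l.
  - rewrite -mulrA normrM normrM (ger0_norm h1); apply: ler_wpM2l => //; exact: mulr_ge0.
  - rewrite normrM normrM (ger0_norm h2) (ger0_norm bb0); apply: ler_wpM2l => //;
      exact: mulr_ge0.
have bL := bnd 3 2 ltac:(lra) ltac:(lra); have bT := bnd 4 4 ltac:(lra) ltac:(lra).
rewrite -/L in bL; rewrite -/T in bT.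
have c1 : `|(j / M - 1) / (M + 1)| <= 1.
  have jM1 : 0 <= j / M <= 1 by rewrite divr_ge0 ?(ltW M0)//= ler_pdivrMr// mul1r.
  rewrite normrM (ger0_norm (_ : 0 <= (M + 1)^-1)) ?invr_ge0; last lra.
  rewrite ler_pdivrMr; last lra.
  by rewrite ler_norml; lra.
have e20 := sqr_ge0 e.
apply: le_trans (ler_normB _ _) _.
have A1 : `|2 * L * ((j / M - 1) / (M + 1))| <= 2 * `|L|.
  by rewrite normrM normrM (ger0_norm (ler0n _ 2)); apply: ler_piMr => //; exact: mulr_ge0.
have A2 : `|(n + j / M) / w * T| <= `|T|.
  rewrite normrM; apply: ler_piMl => //; rewrite ler_norml; lra.
have hS : 0 <= `|S11| * e ^+ 2 /\ 0 <= `|S12| * e ^+ 2 /\ 0 <= `|S22| * e ^+ 2.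
  by split; [|split]; exact: mulr_ge0.
case: hS => h1 [h2 h3].
move: A1 A2 bL bT h1 h2 h3; clear; lra.
Qed.
End Covariance.

(** * Centred counts during a step and their second moments *)

Section Moments.
Context {R : realType}.
Implicit Types (m n j : nat) (d : seq nat).

(* The law after [j] picks of the step that follows time [n]. *)
Definition pick_state m n j := iter j (@pick_step R) (pac_dist R m n).
(* A pick moves these centres by the limiting mean jump, so that the [m] picks and
   the new node move them by the slope [c0], respectively [c0 - c1]. *)
Definition center0 m n j : R := (m%:R + 1) / (2 * m%:R + 1) * n%:R - (2 * m%:R + 1)^-1 *
  j%:R.
Definition center1 m n j : R := (m%:R + 1) / (3 * m%:R + 1) * n%:R - 2 / (3 * m%:R + 1) *
  j%:R.
Definition dev0 m n j d : R := (Ydeg 0 d)%:R - center0 m n j.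
Definition dev1 m n j d : R := (Ydeg 0 d)%:R - (Ydeg 1 d)%:R - center1 m n j.
(** There are [n + 1] eligible nodes and [m n + j] edges; the node being attached counts only once
    it has joined. *)
Definition total_weight m n j : R := (m%:R + 1) * n%:R + 1 + j%:R.

Definition prob0 m : R := (2 * m%:R + 1)^-1.
Definition prob1 m : R := 2 * m%:R / ((3 * m%:R + 1) * (2 * m%:R + 1)).
Definition drift1 m : R := 2 / (3 * m%:R + 1).

Lemma pick_state_law m n j : is_law n.+1 (m * n + j) (pick_state m n j).
Proof. by apply: is_law_picks => //; exact: is_law_pac. Qed.

(** The new leaf raises both [U] and [U - X] by 1. So do the centres, as
    [(m + 1) / (2 m + 1) + m / (2 m + 1)] and [(m + 1) / (3 m + 1) + 2 m / (3 m + 1)] equal 1: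
    attaching a node leaves the deviations alone. *)
Lemma expect_next_node m n F :
  expect (pick_state m n.+1 0) (fun d => F (dev0 m n.+1 0 d) (dev1 m n.+1 0 d)) =
  expect (pick_state m n m) (fun d => F (dev0 m n m d) (dev1 m n m d)).
Proof.
rewrite /pick_state -[iter 0 _ _]/(node_step m (pac_dist R m n)) expect_node_step;
  congr expect.
apply/funext => d; rewrite /dev0 /dev1 !Ydeg_rcons !natrD /center0 /center1 -natr1  /=.
have M_ge0 : 0 <= m%:R :> R by [].
by congr F; field; rewrite gt_eqF//; move: M_ge0; clear; lra.
Qed.

Definition pick_op m n j (F : R -> R -> R) d : R :=
  let x := dev0 m n j d in let y := dev1 m n j d in
  let p0 := (Ydeg 0 d)%:R / total_weight m n j in
  let p1 := 2 * (Ydeg 1 d)%:R / total_weight m n j in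
  p0 * F (x + (prob0 m - 1)) (y + (drift1 m - 2)) +
    p1 * F (x + prob0 m) (y + (drift1 m + 1))
  + (1 - p0 - p1) * F (x + prob0 m) (y + drift1 m).

Lemma total_weightE m n j d : size d = n.+1 -> sumn d = (m * n + j)%N ->
  total_weight m n j = (sumn (map succn d))%:R.
Proof.
move=> sd td; rewrite sumn_map_succn sd td /total_weight !natrD natrM -natr1; ring.
Qed.

Lemma expect_next_pick m n j F :
  expect (pick_state m n j.+1) (fun d => F (dev0 m n j.+1 d) (dev1 m n j.+1 d)) =
  expect (pick_state m n j) (pick_op m n j F).
Proof.
rewrite /pick_state iterS expect_pick_step; apply:
  (eq_expect _ _ _ _ _ (pick_state_law m n j)) => d sd td.
rewrite (pick_meanE (fun u x => F (u - center0 m n j.+1) (u - x - center1 m n j.+1))) ?sd//.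
rewrite /pick_op (total_weightE m _ _ _ sd td) /dev0 /dev1 /center0 /center1 -natr1
  -/(prob0 m) -/(drift1 m).
by congr (_ * F _ _ + _ * F _ _ + _ * F _ _); ring.
Qed.

Lemma total_weight_ge m n j : n%:R + 1 <= total_weight m n j.
Proof.
have M_ge0 : 0 <= m%:R :> R by [].
have n0 : 0 <= n%:R :> R by []. have j0 : 0 <= j%:R :> R by [].
by rewrite /total_weight; move: M_ge0 n0 j0; clear; nra.
Qed.

Lemma total_weight_ge1 m n j : 1 <= total_weight m n j.
Proof. by apply: le_trans (total_weight_ge m n j); rewrite lerDr. Qed.

Lemma pick_probs m n j d : (j <= m)%N -> size d = n.+1 -> sumn d = (m * n + j)%N ->
  let w := total_weight m n j in
  let p0 := (Ydeg 0 d)%:R / w in let p1 := 2 * (Ydeg 1 d)%:R / w in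
  [/\ 0 <= p0, 0 <= p1, p0 + p1 <= 1 &
   exists k0 k1, [/\ `|k0| <= 1, `|k1| <= 1, p0 = prob0 m + (dev0 m n j d + k0) / w &
     p1 = 2 * p0 - drift1 m - 2 * (dev1 m n j d + k1) / w]].
Proof.
move=> jm sd td w p0 p1; have M_ge0 : 0 <= m%:R :> R by [].
have w0 : 0 < w by apply: lt_le_trans (total_weight_ge1 m n j).
split.
- by rewrite divr_ge0// ltW.
- by rewrite divr_ge0 ?mulr_ge0// ltW.
- rewrite -mulrDl ler_pdivrMr// mul1r /w (total_weightE m _ _ _ sd td).
  by rewrite -natrM -natrD ler_nat Ydeg_weight.
have jM : j%:R <= m%:R :> R by rewrite ler_nat.
have j0 : 0 <= j%:R :> R by [].
(* These are [center0 - prob0 * w] and [center1 - drift1 / 2 * w], that is [- (2 j + 1) / (2 m + 1)]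
   and [- (3 j + 1) / (3 m + 1)]; the hypothesis [j <= m] bounds both by 1. *)
exists (- (prob0 m * (2 * j%:R + 1))), (- (drift1 m / 2 * (3 * j%:R + 1))); split.
- rewrite normrN ger0_norm ?mulr_ge0 ?invr_ge0//; try (move: M_ge0 j0; clear; lra).
  rewrite /prob0 mulrC ler_pdivrMr; move: M_ge0 j0 jM; clear; lra.
- have -> : drift1 m / 2 = (3 * m%:R + 1)^-1 by rewrite /drift1; field; rewrite gt_eqF//;
    move: M_ge0; clear; lra.
  rewrite normrN ger0_norm ?mulr_ge0 ?invr_ge0//; try (move: M_ge0 j0; clear; lra).
  rewrite mulrC ler_pdivrMr; move: M_ge0 j0 jM; clear; lra.
- rewrite /p0 /dev0 /center0 /prob0; move: w0; rewrite /w /total_weight => w0.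
  by field; rewrite !gt_eqF//; move: M_ge0; clear; lra.
- rewrite /p1 /p0 /dev1 /center1 /drift1; move: w0; rewrite /w /total_weight => w0.
  by field; rewrite !gt_eqF//; move: M_ge0; clear; lra.
Qed.

Lemma prob_bounds m : (0 < m)%N -> [/\ 0 <= prob0 m, 0 <= prob1 m, prob0 m + prob1 m <=
  1, drift1 m = 2 * prob0 m - prob1 m & 0 <= drift1 m <= 1] /\ prob0 m <= 1.
Proof.
move=> m_gt0; have M_ge0 : 0 <= m%:R :> R by [].
have h2 : 0 < 2 * m%:R + 1 :> R by move: M_ge0; clear; lra.
have h3 : 0 < 3 * m%:R + 1 :> R by move: M_ge0; clear; lra.
have M1 : 1 <= m%:R :> R by rewrite ler1n.
split; last by rewrite /prob0 invf_le1//; move: M_ge0; clear; lra.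
split.
- by rewrite invr_ge0 ltW.
- by rewrite divr_ge0 ?mulr_ge0// ?ltW// .
- have -> : prob0 m + prob1 m = (5 * m%:R + 1) / ((3 * m%:R + 1) * (2 * m%:R + 1)).
    by rewrite /prob0 /prob1; field; rewrite !gt_eqF.
  rewrite ler_pdivrMr ?mulr_gt0// mul1r; move: M1; clear; nra.
- by rewrite /drift1 /prob0 /prob1; field; rewrite !gt_eqF.
- by rewrite /drift1 divr_ge0 ?(ltW h3)//= ler_pdivrMr// mul1r; move: M1; clear; lra.
Qed.

(** The drift pulls both deviations back to 0, so a pick adds at most [3 + 5] to the expected sum of
    squares: at most 1 from each drift, through [k0] and [k1], and 2 and 4 from the squared jumps.
    The weight grows by 1 per pick, hence the factor 8. *)
Lemma second_moment m n j : (0 < m)%N -> (j <= m)%N ->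
  expect (pick_state m n j) (fun d => dev0 m n j d ^+ 2 + dev1 m n j d ^+ 2) <=
    8 * total_weight m n j.
Proof.
move=> m_gt0; pose F (x y : R) := x ^+ 2 + y ^+ 2.
have step i k : (k < m)%N ->
    expect (pick_state m i k) (fun d => F (dev0 m i k d) (dev1 m i k d)) <=
      8 * total_weight m i k ->
    expect (pick_state m i k.+1) (fun d => F (dev0 m i k.+1 d) (dev1 m i k.+1 d)) <=
      8 * total_weight m i k.+1.
  move=> km IH; rewrite expect_next_pick.
  have -> : 8 * total_weight m i k.+1 = 8 * total_weight m i k + 8
    by rewrite /total_weight -natr1; ring.
  apply: le_trans (lerD IH (lexx 8)).
  rewrite -[X in _ + X](expect_cst _ _ _ 8 (pick_state_law m i k)) -[X in X + _]mul1r
    -expect_lin.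
  apply: (le_expect _ _ _ _ _ (pick_state_law m i k)) => d sd td.
  have [] := pick_probs m i k d (ltnW km) sd td.
  rewrite /pick_op; set w := total_weight m i k; set p0 := _ / w; set p1 := 2 * _ / w.
  set x := dev0 m i k d; set y := dev1 m i k d.
  move=> hp0 hp1 hp01 [k0 [k1 [hk0 hk1 E0 E1]]].
  have w1 : 1 <= w := total_weight_ge1 m i k.
  have w0 : 0 < w by apply: lt_le_trans w1.
  have wi : 0 <= w^-1 by rewrite invr_ge0 ltW.
  have wi1 : w^-1 <= 1 by rewrite invf_le1.
  have [[a1 a2 a3 a4 /andP[a5 a6]] a7] := prob_bounds m m_gt0.
  have X : p0 * (x + (prob0 m - 1)) ^+ 2 + p1 * (x + prob0 m) ^+ 2 + (1 - p0 - p1) *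
    (x + prob0 m) ^+ 2 <= x ^+ 2 + 3.
    have -> : p0 * (x + (prob0 m - 1)) ^+ 2 + p1 * (x + prob0 m) ^+ 2 + (1 - p0 - p1) *
      (x + prob0 m) ^+ 2 =
      x ^+ 2 + (2 * x * (prob0 m - p0) + (prob0 m ^+ 2 - 2 * p0 * prob0 m + p0)) by ring.
    have h1 : 2 * x * (prob0 m - p0) <= 1.
      have -> : 2 * x * (prob0 m - p0) = - (2 * (x ^+ 2 + x * k0)) * w^-1 by rewrite E0;
        ring.
      apply: (@le_trans _ _ (1 * w^-1)); last by rewrite mul1r.
      apply: ler_wpM2r => //.
      have k2 : k0 ^+ 2 <= 1 by rewrite -(real_normK (num_real k0)) expr_le1.
      have := sqr_ge0 (2 * x + k0); move: k2; clear; nra.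
    have h2 : prob0 m ^+ 2 - 2 * p0 * prob0 m + p0 <= 2.
      have p01 : p0 <= 1 by move: hp1 hp01; clear; lra.
      have : 0 <= p0 * prob0 m by exact: mulr_ge0.
      have : prob0 m ^+ 2 <= 1 by rewrite expr_le1.
      move: p01; clear; nra.
    move: h1 h2; clear; lra.
  have Y : p0 * (y + (drift1 m - 2)) ^+ 2 + p1 * (y + (drift1 m + 1)) ^+ 2 +
    (1 - p0 - p1) * (y + drift1 m) ^+ 2 <= y ^+ 2 + 5.
    have -> : p0 * (y + (drift1 m - 2)) ^+ 2 + p1 * (y + (drift1 m + 1)) ^+ 2 +
      (1 - p0 - p1) * (y + drift1 m) ^+ 2 =
      y ^+ 2 + (2 * y * (drift1 m - 2 * p0 + p1) +
        (p0 * (drift1 m - 2) ^+ 2 + p1 * (drift1 m + 1) ^+ 2 + (1 - p0 - p1) *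
          drift1 m ^+ 2)) by ring.
    have h1 : 2 * y * (drift1 m - 2 * p0 + p1) <= 1.
      have -> : 2 * y * (drift1 m - 2 * p0 + p1) = - (4 * (y ^+ 2 + y * k1)) * w^-1
        by rewrite E1; ring.
      apply: (@le_trans _ _ (1 * w^-1)); last by rewrite mul1r.
      apply: ler_wpM2r => //.
      have k2 : k1 ^+ 2 <= 1 by rewrite -(real_normK (num_real k1)) expr_le1.
      have := sqr_ge0 (2 * y + k1); move: k2; clear; nra.
    have h2 : p0 * (drift1 m - 2) ^+ 2 + p1 * (drift1 m + 1) ^+ 2 + (1 - p0 - p1) *
      drift1 m ^+ 2 <= 4.
      have b0 : (drift1 m - 2) ^+ 2 <= 4 by move: a5 a6; clear; nra.
      have b1 : (drift1 m + 1) ^+ 2 <= 4 by move: a5 a6; clear; nra.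
      have b2 : drift1 m ^+ 2 <= 4 by move: a5 a6; clear; nra.
      have hp2 : 0 <= 1 - p0 - p1 by move: hp01; clear; lra.
      have := ler_wpM2l hp0 b0; have := ler_wpM2l hp1 b1; have := ler_wpM2l hp2 b2.
      clear; lra.
    move: h1 h2; clear; lra.
  move: X Y; rewrite /F mul1r; clear; lra.
elim: n j => [|n IHn] j jm; elim: j jm => [|j IHj] jm.
- rewrite /expect /pick_state /pac_dist /= big_seq1 /= /dev0 /dev1 /center0 /center1
    /total_weight /Ydeg /=.
  rewrite !mulr0 !subr0; lra.
- by apply: step => //; apply: IHj; exact: ltnW.
- rewrite (expect_next_node m n F); apply: le_trans (IHn m (leqnn m)) _.
  rewrite /total_weight -natr1 ; lra.
- by apply: step => //; apply: IHj; exact: ltnW.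
Qed.
End Moments.

(** * Characteristic functions of the counts *)

Section CharacteristicFunction.
Context {R : realType}.
Implicit Types (m n j : nat) (d : seq nat) (al be th : R).

Definition dev_cf m n j al be th : R :=
  expect (pick_state m n j) (fun d => cos (al * dev0 m n j d + be * dev1 m n j d + th)).

(** This averages [pick_cos], with [K1 = 1] from [pick_probs]. The 9 is 1 from the term [1 / w] plus
    8 from [second_moment]. *)
Lemma dev_cf_step (m : nat) (K : R) : (0 < m)%N -> 0 <= K ->
  exists2 C, 0 <= C & forall n j al be th, (j < m)%N ->
  let e := `|al| + `|be| in let w : R := total_weight m n j in
  e <= K ->
  `|dev_cf m n j.+1 al be th - expR (- (pick_var m%:R al be / 2)) *
     dev_cf m n j (al * (1 - w^-1)) (be * (1 - 2 / w)) th| <= C * e * (e ^+ 2 + 9 / w).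
Proof.
move=> m_gt0 K0.
have [[a1 a2 a3 a4 a5] a6] := @prob_bounds R m m_gt0.
have [C C0 HC] := pick_cos K 1 _ _ _ K0 ler01 a1 a2 a3 a4 a5.
exists C => // n j al be th jm e w eK.
have ls := @pick_state_law R m n j.
have w1 : 1 <= w by exact: total_weight_ge1.
have w0 : 0 < w by apply: lt_le_trans w1.
have e0 : 0 <= e by rewrite addr_ge0.
rewrite /dev_cf (expect_next_pick m n j (fun x y => cos (al * x + be * y + th))).
set E := expR _.
have -> : E * expect (pick_state m n j) (fun d => cos (al * (1 - w^-1) * dev0 m n j d +
  be * (1 - 2 / w) * dev1 m n j d + th)) =
  expect (pick_state m n j) (fun d => E * cos (al * (1 - w^-1) * dev0 m n j d +
    be * (1 - 2 / w) * dev1 m n j d + th) + 0).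
  by rewrite expect_lin (expect_cst _ _ _ 0 ls) addr0.
pose err d := (C * e / w ^+ 2) * (dev0 m n j d ^+ 2 + dev1 m n j d ^+ 2) +
  C * e * (e ^+ 2 + w^-1).
apply: (@le_trans _ _ (expect (pick_state m n j) err)).
  apply: (expect_dist _ _ _ _ _ _ ls) => d sd td.
  have [] := @pick_probs R m n j d (ltnW jm) sd td.
  rewrite -/w => hp0 hp1 hp01 [k0 [k1 [hk0 hk1 E0 E1]]].
  have := HC al be th (dev0 m n j d) (dev1 m n j d) w _ _ k0 k1 eK w1 hp0 hp1 hp01 E0 E1
    hk0 hk1.
  have -> : C * e * (e ^+ 2 + w^-1 + (dev0 m n j d ^+ 2 + dev1 m n j d ^+ 2) / w ^+ 2) =
    err d.
    by rewrite /err; ring.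
  move=> H; apply: le_trans H; rewrite /pick_op -/w addr0.
  have ch (x y z : R) : al * (dev0 m n j d + x) + be * (dev1 m n j d + y) + th =
     al * dev0 m n j d + be * dev1 m n j d + th + (al * x + be * y) by ring.
  by rewrite !ch.
rewrite /err expect_lin (expect_cst _ _ _ _ ls).
have Ce : 0 <= C * e by exact: mulr_ge0.
have h : 0 <= C * e / w ^+ 2 by rewrite divr_ge0// sqr_ge0.
have := ler_wpM2l h (second_moment m n j m_gt0 (ltnW jm)).
have -> : C * e / w ^+ 2 * (8 * total_weight m n j) = C * e * (8 / w).
  by rewrite -/w; field; rewrite gt_eqF.
clear; lra.
Qed.

(** The 1 accounts for the initial state; each pick made after time [k] contributes [1 / (k + 1)], a
    bound for the inverse weight. *)
Definition harmonic_bound m n j : R :=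
  1 + m%:R * (\sum_(k < n) k.+1%:R^-1) + j%:R / n.+1%:R.

Lemma dev_cf_bound m (K : R) : (0 < m)%N -> 0 <= K ->
  exists2 C, 0 <= C & forall n j al be th, (j <= m)%N ->
  (`|al| + `|be|) ^+ 2 * n.+1%:R <= K ^+ 2 ->
  `|dev_cf m n j al be th
    - expR (- ((n%:R + j%:R / m%:R) * qform m%:R al be / 2)) * cos th|
  <= C * (`|al| + `|be|) * harmonic_bound m n j.
Proof.
move=> m_gt0 K0.
have M0 : 0 < m%:R :> R by rewrite ltr0n.
have [C1 C10 H1] := dev_cf_step m K m_gt0 K0.
have [C2 C20 H2] := qform_step m%:R M0.
(* One summand for each source: the initial state, the error of a pick, and the error of the
   Gaussian recursion. *)
pose C := 2 + C1 * (K ^+ 2 + 9) + C2 * K.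
have K20 := sqr_ge0 K.
have C0 : 0 <= C.
  have := mulr_ge0 C10 (addr_ge0 K20 (ler0n R 9)); have := mulr_ge0 C20 K0; rewrite /C; lra.
exists C => //.
have step n j : (j < m)%N ->
  (forall al be th, (`|al| + `|be|) ^+ 2 * n.+1%:R <= K ^+ 2 ->
  `|dev_cf m n j al be th - expR (- ((n%:R + j%:R / m%:R) * qform m%:R al be / 2)) * cos th|
  <= C * (`|al| + `|be|) * harmonic_bound m n j) ->
  forall al be th, (`|al| + `|be|) ^+ 2 * n.+1%:R <= K ^+ 2 ->
  `|dev_cf m n j.+1 al be th - expR (- ((n%:R + j.+1%:R / m%:R) * qform m%:R al be / 2)) *
    cos th|
  <= C * (`|al| + `|be|) * harmonic_bound m n j.+1.
  move=> jm IH al be th heK.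
  pose w : R := total_weight m n j.
  set e := `|al| + `|be| in heK *.
  have e0 : 0 <= e by rewrite addr_ge0.
  have n1 : 1 <= n.+1%:R :> R by rewrite ler1n.
  have n10 : 0 < n.+1%:R :> R by [].
  have e2K : e ^+ 2 <= K ^+ 2 by apply: le_trans heK; apply: ler_peMr => //; exact: sqr_ge0.
  have eK : e <= K by move: e2K; rewrite ler_sqr ?nnegrE.
  have w1 : 1 <= w by exact: total_weight_ge1.
  have wn : n.+1%:R <= w by rewrite -natr1; exact: total_weight_ge.
  have w0 : 0 < w by apply: lt_le_trans w1.
  have wi : w^-1 <= n.+1%:R^-1 by rewrite lef_pV2.
  have wi0 : 0 < w^-1 by rewrite invr_gt0.
  have e2n : e ^+ 2 <= K ^+ 2 / n.+1%:R by rewrite ler_pdivlMr.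
  set al' := al * (1 - w^-1); set be' := be * (1 - 2 / w).
  have wi1 : w^-1 <= 1 by rewrite invf_le1.
  have hal : `|al'| <= `|al|.
    by rewrite normrM; apply: ler_piMr => //; rewrite ler_norml; move: wi0 wi1; clear; lra.
  have hbe : `|be'| <= `|be|.
    by rewrite normrM; apply: ler_piMr => //; rewrite ler_norml; move: wi0 wi1; clear; lra.
  have he' : `|al'| + `|be'| <= e by exact: lerD.
  have he2 : (`|al'| + `|be'|) ^+ 2 * n.+1%:R <= K ^+ 2.
    apply: le_trans heK; apply: ler_wpM2r => //.
    by rewrite lerXn2r// nnegrE addr_ge0.
  have := IH al' be' th he2.
  have S1 := H1 n j al be th jm eK.
  rewrite -/w -/e -/al' -/be' in S1.
  set P := dev_cf _ _ _ _ _ _ in S1 *.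
  set P' := dev_cf _ _ _ al' be' _ in S1 *.
  set q := pick_var _ _ _ in S1.
  have q0 : 0 <= q.
    have [[a1 a2 a3 a4 a5] a6] := @prob_bounds R m m_gt0.
    rewrite /q /pick_var -/(prob0 m) -/(prob1 m) addr_ge0 ?addr_ge0// mulr_ge0 ?sqr_ge0//.
    by rewrite -addrA -opprD subr_ge0.
  set Q := qform _ al be; set Q' := qform _ al' be'.
  set G := expR (- (_ * Q' / 2)) => S2.
  have Q0 : 0 <= Q by exact: qform_ge0.
  have Q'0 : 0 <= Q' by exact: qform_ge0.
  have jM0 : 0 <= j%:R / m%:R :> R by rewrite divr_ge0.
  have S3 : `|expR (- ((n%:R + j.+1%:R / m%:R) * Q / 2)) - expR (- (q / 2)) * G| <=
    C2 * K * e * n.+1%:R^-1.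
    rewrite /G -expRD -opprD.
    apply: le_trans (expRN_dist_le _ _ _ _) _.
    - by apply: divr_ge0 => //; apply: mulr_ge0 => //; apply: addr_ge0 => //;
        exact: divr_ge0.
    - apply: addr_ge0; first exact: divr_ge0.
      by apply: divr_ge0 => //; apply: mulr_ge0 => //; exact: addr_ge0.
    have jmR : 0 <= (j%:R : R) <= m%:R by rewrite ler0n ler_nat ltnW.
    have h := H2 n%:R j%:R al be w (ler0n _ _) jmR erefl.
    rewrite natr1 -/q -/al' -/be' -/Q -/Q' -/e in h.
        have -> : (n%:R + j.+1%:R / m%:R) * Q / 2 -
          (q / 2 + (n%:R + j%:R / m%:R) * Q' / 2) =
      ((n%:R + j.+1%:R / m%:R) * Q - q - (n%:R + j%:R / m%:R) * Q') / 2 by field;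
        rewrite gt_eqF.
    rewrite normrM (ger0_norm (_ : 0 <= 2^-1))//.
    apply: (@le_trans _ _ (C2 * e ^+ 2 / w)).
      apply: le_trans (ler_piMr (normr_ge0 _) _) h; rewrite invf_le1// ler1n//.
    have -> : C2 * K * e * n.+1%:R^-1 = C2 * (e * K) * n.+1%:R^-1 by ring.
    apply: ler_pM => //; first by rewrite mulr_ge0// sqr_ge0.
      exact: ltW.
    by rewrite ler_wpM2l// expr2 ler_wpM2l.
  have S1' : C1 * e * (e ^+ 2 + 9 / w) <= C1 * (K ^+ 2 + 9) * e * n.+1%:R^-1.
    have -> : C1 * (K ^+ 2 + 9) * e * n.+1%:R^-1 =
      C1 * e * (K ^+ 2 / n.+1%:R + 9 / n.+1%:R) by ring.
    apply: ler_wpM2l; first exact: mulr_ge0.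
    by apply: lerD => //; apply: ler_wpM2l.
  set E := expR (- (q / 2)) in S1 S3.
  have E1 : `|E| <= 1 by rewrite ger0_norm ?expR_ge0// -expR0 ler_expR oppr_le0 divr_ge0.
  set G1 := expR (- (_ * Q / 2)) in S3 *.
  have c1 : `|cos th| <= 1 by rewrite ler_norml cos_geN1 cos_le1.
  (* The error of this pick, the inherited error damped by [E <= 1], and the defect of the Gaussian
     exponents. *)
  have -> : P - G1 * cos th = (P - E * P') + E * (P' - G * cos th) - (G1 - E * G) * cos th
    by ring.
  apply: le_trans (ler_normB _ _) _; apply: le_trans (lerD (ler_normD _ _) (lexx _)) _.
  have T2 : `|E * (P' - G * cos th)| <= C * e * harmonic_bound m n j.
    rewrite normrM; apply: le_trans (ler_piMl _ E1) _ => //; apply: (le_trans S2).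
    apply: ler_wpM2r; last exact: ler_wpM2l.
    by rewrite /harmonic_bound !addr_ge0 ?divr_ge0 ?mulr_ge0 ?sumr_ge0// => k _;
      rewrite invr_ge0.
  have T3 : `|(G1 - E * G) * cos th| <= C2 * K * e * n.+1%:R^-1.
    by rewrite normrM; apply: le_trans (ler_piMr _ c1) _.
  have -> : harmonic_bound m n j.+1 = harmonic_bound m n j + n.+1%:R^-1.
    by rewrite /harmonic_bound -(natr1 j) mulrDl mul1r addrA.
  have en : 0 <= e * n.+1%:R^-1 by rewrite mulr_ge0// invr_ge0.
  have -> : C * e * (harmonic_bound m n j + n.+1%:R^-1) = C * e * harmonic_bound m n j +
      (2 * (e / n.+1%:R) + C1 * (K ^+ 2 + 9) * e / n.+1%:R + C2 * K * e / n.+1%:R).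
    by rewrite /C; ring.
  have aux (x1 x2 x3 y1 y2 y3 z : R) : x1 <= y1 -> x2 <= y2 -> x3 <= y3 -> 0 <= z ->
      x1 + x2 + x3 <= y2 + (2 * z + y1 + y3) by clear; lra.
  exact: aux (le_trans S1 S1') T2 T3 en.
move=> n j; elim: n j => [|n IHn] j al be th jm;
  elim: j jm al be th => [|j IHj] jm al be th heK.
(* At time 0 the single node has outdegree 0 and both deviations are 1, so [cos (al + be + th)] is
   compared with [cos th]. *)
- rewrite /dev_cf /expect /pick_state /pac_dist /= big_seq1 /= /dev0 /dev1 /center0
    /center1 /Ydeg /=.
  rewrite /harmonic_bound big_ord0 !(mulr0, mul0r, subr0, addr0, add0r) oppr0 expR0 !mul1r
    !mulr1.
  rewrite addn0 !subr0 !mulr1 [al + be + th]addrC.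
  apply: le_trans (cosD_sub_le _ _) _.
  have h : `|al + be| <= `|al| + `|be| by exact: ler_normD.
  have hC : 2 <= C.
    have := mulr_ge0 C10 (addr_ge0 K20 (ler0n R 9)); have := mulr_ge0 C20 K0; rewrite /C;
      lra.
  apply: ler_pM => //.
- apply: step => // al0 be0 th0 h0; apply: IHj => //; exact: ltnW.
- have -> : dev_cf m n.+1 0 al be th = dev_cf m n m al be th.
    exact: (expect_next_node m n (fun x y => cos (al * x + be * y + th))).
  have -> : n.+1%:R + 0%:R / m%:R = n%:R + m%:R / m%:R :> R.
    by rewrite mul0r addr0 divff ?gt_eqF// natr1.
  have -> : harmonic_bound m n.+1 0 = harmonic_bound m n m.
    by rewrite /harmonic_bound big_ord_recr /= mul0r addr0 mulrDr addrA.
  apply: IHn => //; apply: le_trans heK; apply: ler_wpM2l; first exact: sqr_ge0.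
  by rewrite ler_nat.
- apply: step => // al0 be0 th0 h0; apply: IHj => //; exact: ltnW.
Qed.

(** Any power below [1 / 2] would do in place of the logarithm. With [a] and [b] the fourth roots of
    [n] and [n + 1], [1 = b ^+ 4 - a ^+ 4 <= 4 (b - a) b ^+ 3], and [b >= 1]. *)
Lemma sum_inv_le_root4 n : \sum_(k < n) (k.+1%:R : R)^-1 <= 4 * Num.sqrt (Num.sqrt n%:R).
Proof.
elim: n => [|n IH]; first by rewrite big_ord0 !sqrtr0 mulr0.
rewrite big_ord_recr /=.
set a := Num.sqrt (Num.sqrt n%:R) in IH *; set b := Num.sqrt (Num.sqrt n.+1%:R).
have a0 : 0 <= a by exact: sqrtr_ge0.
have b0 : 0 <= b by exact: sqrtr_ge0.
have a4 : a ^+ 4 = n%:R.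
  by rewrite (exprM a 2 2) /a !sqr_sqrtr ?sqrtr_ge0.
have b4 : b ^+ 4 = n.+1%:R.
  by rewrite (exprM b 2 2) /b !sqr_sqrtr ?sqrtr_ge0.
have ab : a <= b by rewrite /a /b !ler_wsqrtr// ler_nat.
have b1 : 0 < b by rewrite /b !sqrtr_gt0.
have bp : 0 < b ^+ 4 by exact: exprn_gt0.
have key : 1 <= 4 * (b - a) * b ^+ 3.
  have E : 1 = (b - a) * (b ^+ 3 + b ^+ 2 * a + b * a ^+ 2 + a ^+ 3).
    transitivity (b ^+ 4 - a ^+ 4); last by ring.
    by rewrite a4 b4 -natr1 addrAC subrr add0r.
  rewrite [leLHS]E (_ : 4 * (b - a) * b ^+ 3 = (b - a) * (4 * b ^+ 3)); last by ring.
  apply: ler_wpM2l; first by rewrite subr_ge0.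
  have h1 : b ^+ 2 * a <= b ^+ 3 by rewrite (exprSr b 2) ler_wpM2l// sqr_ge0.
  have a2 : a ^+ 2 <= b ^+ 2 by rewrite lerXn2r.
  have h2 : b * a ^+ 2 <= b ^+ 3 by rewrite (exprS b 2) ler_wpM2l.
  have h3 : a ^+ 3 <= b ^+ 3 by rewrite lerXn2r.
  move: h1 h2 h3; clear; lra.
have b_le : b ^+ 3 <= b ^+ 4.
  have b1' : 1 <= b by rewrite -(sqrtr1 R) /b -{1}(sqrtr1 R) !ler_wsqrtr// ler1n.
  by rewrite (exprSr b 3); apply: ler_peMr => //; exact: exprn_ge0.
have h : n.+1%:R^-1 <= 4 * (b - a).
  rewrite -b4 -[leLHS]mul1r ler_pdivrMr//; apply: le_trans key _.
  by apply: ler_wpM2l => //; apply: mulr_ge0 => //; rewrite subr_ge0.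
by apply: le_trans (lerD IH h) _; rewrite -mulrDr addrC subrK.
Qed.

Lemma cvg_harmonic_bound_sqrt0 m : (fun n => harmonic_bound m n 0 / Num.sqrt n%:R) @ \oo
  --> 0.
Proof.
have r4 : (fun n : nat => (Num.sqrt (Num.sqrt n%:R) : R)^-1) @ \oo --> 0.
  apply/cvgrPdist_le => e e0.
  exists (Num.truncn (e^-1 ^+ 4)).+1 => // n /= hn.
  rewrite sub0r normrN ger0_norm ?invr_ge0 ?sqrtr_ge0//.
  have he : 0 < e^-1 by rewrite invr_gt0.
  rewrite -[leRHS]invrK lef_pV2 ?posrE//; last by rewrite !sqrtr_gt0 ltr0n (leq_trans _ hn).
  rewrite -(@ler_pXn2r _ 4)// ?nnegrE ?sqrtr_ge0 ?(ltW he)//.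
  rewrite [leRHS](exprM _ 2 2) !sqr_sqrtr ?sqrtr_ge0//.
  apply: ltW; apply: lt_le_trans (truncnS_gt _) _.
  by rewrite ler_nat.
have r40 : (fun n : nat => (1 + 4 * m%:R) * (Num.sqrt (Num.sqrt n%:R) : R)^-1) @ \oo --> 0.
  by rewrite -[X in _ --> X](mulr0 (1 + 4 * m%:R : R)); exact: cvgMr.
apply: (squeeze_cvgr _ (cvg_cst 0) r40).
near=> n.
have n0 : (0 < n)%N by near: n; exact: nbhs_infty_gt.
have h : 0 <= \sum_(k < n) (k.+1%:R : R)^-1 by rewrite sumr_ge0// => k _; rewrite invr_ge0.
have s0 : 0 < Num.sqrt (n%:R : R) by rewrite sqrtr_gt0 ltr0n.
rewrite divr_ge0 ?sqrtr_ge0//=; last by rewrite /harmonic_bound mul0r addr0 addr_ge0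
  ?mulr_ge0.
rewrite ler_pdivrMr// /harmonic_bound mul0r addr0.
set r := Num.sqrt (Num.sqrt _).
have r0 : 0 < r by rewrite /r sqrtr_gt0.
have r1 : 1 <= r.
  by rewrite -(@ler_pXn2r _ 4)// ?nnegrE ?(ltW r0)// expr1n [leRHS](exprM _ 2 2)
    !sqr_sqrtr ?sqrtr_ge0// ler1n.
have -> : Num.sqrt n%:R = r ^+ 2 by rewrite sqr_sqrtr// sqrtr_ge0.
have -> : (1 + 4 * m%:R) * r^-1 * r ^+ 2 = (1 + 4 * m%:R) * r by field; rewrite gt_eqF.
rewrite mulrDl mul1r lerD// (mulrC 4) -mulrA ler_wpM2l//.
exact: sum_inv_le_root4.
Unshelve. all: end_near. Qed.
End CharacteristicFunction.

Theorem theorem2 (R : realType) (m : nat) (hm : (2 <= m)%N) :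
  let M : R := m%:R in
  let c0 : R := (M + 1) / (2 * M + 1) in
  let c1 : R := M * (M + 1) / ((3 * M + 1) * (2 * M + 1)) in
  let s11 : R := 2 * M ^+ 2 * (M + 1) / ((3 * M + 1) * (2 * M + 1) ^+ 2) in
  let s12 : R := - (4 * (M + 1) ^+ 2 * M ^+ 2
                   / ((4 * M + 1) * (3 * M + 1) * (2 * M + 1) ^+ 2)) in
  let s22 : R := 2 * M ^+ 2 * (M + 1)
                 * (48 * M ^+ 3 + 59 * M ^+ 2 + 27 * M + 4)
                 / ((5 * M + 1) * (4 * M + 1) * (3 * M + 1) ^+ 2
                    * (2 * M + 1) ^+ 2) in
  cvg_dist_binormal
    (fun n (f : R * R -> R) =>
       pac_expect m n (fun d =>
         f (((Ydeg 0 d)%:R - c0 * n%:R) / Num.sqrt n%:R,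
            ((Ydeg 1 d)%:R - c1 * n%:R) / Num.sqrt n%:R)))
    s11 s12 s22.
Proof.
move=> M c0 c1 s11 s12 s22.
have m_gt0 : (0 < m)%N by apply: leq_trans hm.
have M0 : 0 < M by rewrite /M ltr0n.
pose V n d : R * R := (((Ydeg 0 d)%:R - c0 * n%:R) / Num.sqrt n%:R,
            ((Ydeg 1 d)%:R - c1 * n%:R) / Num.sqrt n%:R).
have law n := @pick_state_law R m n 0.
have V1 n d : (V n d).1 = dev0 m n 0 d / Num.sqrt n%:R.
  by rewrite /V /dev0 /center0 mulr0 subr0.
have V2 n d : (V n d).2 = (dev0 m n 0 d - dev1 m n 0 d) / Num.sqrt n%:R.
  rewrite /V /dev0 /dev1 /center0 /center1 /c1 /=; congr (_ / _); rewrite -/M.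
  by field; rewrite !gt_eqF//; move: M0; clear; lra.
have sqn (n : nat) : (0 < n)%N -> 0 < Num.sqrt (n%:R : R) by move=> n0;
  rewrite sqrtr_gt0 ltr0n.
(* The constant is [3 * 8 * (M + 2)]: 3 from passing back to [(U, X)], 8 from [second_moment], and
   [(M + 1) n + 1 <= (M + 2) n]. *)
apply: (@cvg_dist_of_cf R (fun n f => expect (pick_state m n 0) (fun d => f (V n d))) s11
  s12 s22 (24 * (M + 2))).
- exact: sig11_gt0.
- exact: sig_det_gt0.
- by move=> n k f g; rewrite expect_lin.
- by move=> n f g fg; apply: (le_expect _ _ _ _ _ (law n)) => d _ _; exact: fg.
- by move=> n; rewrite (expect_cst _ _ _ _ (law n)).
(* At [n = 0] the inverse of [sqrt 0] is 0 by convention, so the vector vanishes. *)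
- case=> [|n].
    apply: (@le_trans _ _ (expect (pick_state m 0 0) (fun=> 0))); last first.
      by rewrite (expect_cst _ _ _ _ (law 0%N)); move: M0; clear; lra.
    apply: (le_expect _ _ _ _ _ (law 0%N)) => d _ _.
    by rewrite V1 V2 sqrtr0 invr0 !mulr0 expr0n addr0.
  have n0 : 0 < n.+1%:R :> R by [].
  have n1 : 1 <= n.+1%:R :> R by rewrite ler1n.
  apply: (@le_trans _ _ (expect (pick_state m n.+1 0)
    (fun d => 3 / n.+1%:R * (dev0 m n.+1 0 d ^+ 2 + dev1 m n.+1 0 d ^+ 2) + 0))).
    apply: (le_expect _ _ _ _ _ (law n.+1)) => d _ _.
    rewrite V1 V2 !expr_div_n sqr_sqrtr ?(ltW n0)// -mulrDl addr0 [leRHS]mulrAC ler_pM2r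
      ?invr_gt0//.
    have := sqr_ge0 (dev0 m n.+1 0 d + dev1 m n.+1 0 d).
    have := sqr_ge0 (dev1 m n.+1 0 d); have := sqr_ge0 (dev0 m n.+1 0 d); clear; nra.
  rewrite expect_lin (expect_cst _ _ _ _ (law n.+1)) addr0.
  have h : 0 <= 3 / n.+1%:R :> R by rewrite divr_ge0.
  apply: le_trans (ler_wpM2l h (second_moment m n.+1 0 m_gt0 isT)) _.
  rewrite /total_weight -/M addr0 mulrAC ler_pdivrMr//.
  by move: M0 n1; clear; nra.
move=> al be th.
set L := expR _ * cos th.
pose S := `|al + be| + `|be|.
have S0 : 0 <= S by rewrite addr_ge0.
(* The factor 2 absorbs the difference between [n + 1] in the hypothesis of [dev_cf_bound] and [n]
   in the normalization. *)
have [C C0 HC] := @dev_cf_bound R m (2 * S) m_gt0 (mulr_ge0 (ler0n _ 2) S0).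
have cvh : (fun n => C * S * (harmonic_bound m n 0 / Num.sqrt n%:R)) @ \oo --> (0 : R).
  by rewrite -[X in _ --> X](mulr0 (C * S)); apply: cvgMr; exact: cvg_harmonic_bound_sqrt0.
apply/cvgrPdist_le => e e0.
move/cvgrPdist_le : cvh => /(_ e e0); apply: filter_app; near=> n => hn.
have n0 : (0 < n)%N by near: n; exact: nbhs_infty_gt.
have n0R : 0 < n%:R :> R by rewrite ltr0n.
have n1 : 1 <= n%:R :> R by rewrite ler1n.
have s0 := sqn n n0.
have sE : Num.sqrt n%:R ^+ 2 = n%:R :> R by rewrite sqr_sqrtr// ltW.
set r := Num.sqrt n%:R in hn s0 sE.
(* Since [X = U - (U - X)], the frequencies [(al, be)] for [(U, X)] become [(al + be, - be)] for
   [(U, U - X)]. *)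
have -> : expect (pick_state m n 0) (fun d => cos (al * (V n d).1 + be * (V n d).2 + th)) =
   dev_cf m n 0 ((al + be) / r) (- be / r) th.
  rewrite /dev_cf; congr expect; apply/funext => d; rewrite V1 V2 -/r; congr (cos _); ring.
have SE : `|(al + be) / r| + `|- be / r| = S / r.
  by rewrite !normrM normrN (ger0_norm (_ : 0 <= r^-1)) ?invr_ge0 ?(ltW s0)// -mulrDl.
have hK : (`|(al + be) / r| + `|- be / r|) ^+ 2 * n.+1%:R <= (2 * S) ^+ 2.
  rewrite SE expr_div_n sE mulrAC ler_pdivrMr// -natr1.
  by have := sqr_ge0 S; move: n1; clear; nra.
have := HC n 0%N _ _ th (leq0n m) hK.
rewrite SE mul0r addr0.
have -> : n%:R * qform m%:R ((al + be) / r) (- be / r) / 2 =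
   (s11 * al ^+ 2 + 2 * s12 * al * be + s22 * be ^+ 2) / 2.
  rewrite -[in LHS]sE /qform -[sig11 _]/s11 -[sig12 _]/s12 -[sig22 _]/s22.
  by field; rewrite gt_eqF.
rewrite -/L distrC => hb; apply: (le_trans hb).
move: hn; rewrite sub0r normrN; apply: le_trans.
have -> : C * (S / r) * harmonic_bound m n 0 = C * S * (harmonic_bound m n 0 / r) by ring.
exact: ler_norm.
Unshelve. all: end_near. Qed.
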